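(* Let $a,b\in\mathbb{R}^n$, $c_0\in\mathbb{R}$, $V\in C^\infty(\mathbb{T}^n)$, and let $u\in C^\infty(\mathbb{R}^n)$ be a strictly convex solution of $$\det D^2u=\exp\{-a\cdot Du+b\cdot x+V(x)-c_0\}\qquad\text{in }\mathbb{R}^n.$$ Suppose that, for some real symmetric positive definite $n\times n$ matrix $A$ and some $\ell\in\mathbb{R}^n$, the function $$f(x)=u(x)-\tfrac12x^\top Ax-\ell\cdot x$$ satisfies $\sup_{B_R}|f|=o(R^2)$ as $R\to\infty$. Then $b=Aa$. If, in addition, $f\in L^\infty(\mathbb{R}^n)$, then $$c_0+a\cdot\ell=c_A$$ and $$u(x)=\tfrac12x^\top Ax+\ell\cdot x+\psi_A(x)+C$$ for some $C\in\mathbb{R}$.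
   Context: $\mathbb{T}^n=\mathbb{R}^n/\mathbb{Z}^n$ (volume one); functions on $\mathbb{T}^n$ are identified with $\mathbb{Z}^n$-periodic functions on $\mathbb{R}^n$. Strictly convex means that the Hessian $D^2u$ is positive definite everywhere. $B_R$ is the Euclidean ball of radius $R$ centered at the origin. For given symmetric $A>0$, $a\in\mathbb{R}^n$, $V\in C^\infty(\mathbb{T}^n)$, the pair $(\psi_A,c_A)$ denotes the unique pair (it exists and is unique) with $\psi_A\in C^\infty(\mathbb{T}^n)$, $\int_{\mathbb{T}^n}\psi_A=0$, $c_A\in\mathbb{R}$, satisfying $$\det(A+D^2\psi_A)=\exp\{-a\cdot D\psi_A+V-c_A\},\qquad A+D^2\psi_A>0\quad\text{on }\mathbb{T}^n.$$ *)

(* Defs.v *)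
From HB Require Import structures.
From mathcomp Require Import all_boot all_order all_algebra.
From mathcomp Require Import all_classical all_reals all_analysis.

Set Implicit Arguments.
Unset Strict Implicit.
Unset Printing Implicit Defensive.

Import Order.TTheory GRing.Theory Num.Theory.
Import numFieldNormedType.Exports.

Local Open Scope classical_set_scope.
Local Open Scope ring_scope.

(* Vectors of R^n are row vectors. The norm that the library puts on 'rV[R]_n
   is the sup norm, so the Euclidean norm is defined separately. *)
Definition dotv (R : realType) n (x y : 'rV[R]_n) : R :=
  \sum_(i < n) x 0 i * y 0 i.

Definition euclidean_ball (R : realType) n (r : R) : set 'rV[R]_n :=
  [set x | Num.sqrt (dotv x x) < r].

(* y^T M y for the column vector y = x^T *)
Definition quad_form (R : realType) n (M : 'M[R]_n) (x : 'rV[R]_n) : R :=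
  (x *m M *m x^T) 0 0.

Definition sym_posdef (R : realType) n (M : 'M[R]_n) : Prop :=
  M^T = M /\ forall x : 'rV[R]_n, x != 0 -> 0 < quad_form M x.

Section calculus.
Context {R : realType} {n : nat}.
Implicit Types (f : 'rV[R]_n -> R) (x : 'rV[R]_n) (i j : 'I_n).

Definition partial i f : 'rV[R]_n -> R := fun x => 'D_(delta_mx 0 i) f x.

(* partial_seq [:: i1; ...; ik] f is d_i1 (... (d_ik f)) *)
Definition partial_seq (s : seq 'I_n) f : 'rV[R]_n -> R := foldr partial f s.

(* 'D_v f x is a total operator, hence the explicit derivability clause *)
Definition smooth f : Prop :=
  forall s : seq 'I_n,
    continuous (partial_seq s f) /\
    forall x i, derivable (partial_seq s f) x (delta_mx 0 i).

Definition gradient f x : 'rV[R]_n := \row_i partial i f x.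

Definition hessian f x : 'M[R]_n := \matrix_(i, j) partial i (partial j f) x.

Definition strictly_convex f : Prop := forall x, sym_posdef (hessian f x).

Definition Zn_periodic f : Prop :=
  forall (k : 'rV[int]_n) x, f (x + map_mx intr k) = f x.

End calculus.

Section lebesgue_measure_Rn.
Context (R : realType).

Definition consp n (p : n.-tuple R * measurableTypeR R) : n.+1.-tuple R :=
  [tuple of p.2 :: p.1].

Lemma measurable_consp n :
  measurable_fun [set: n.-tuple R * measurableTypeR R] (@consp n).
Proof. exact: measurable_cons. Qed.

Definition prod_lebesgue n (mu : {measure set (n.-tuple R) -> \bar R}) :=
  pushforward (mu \x @lebesgue_measure R)%E (@consp n).

Section prod_lebesgue_measure.
Context n (mu : {measure set (n.-tuple R) -> \bar R}).

Let nu : {measure set (n.+1.-tuple R) -> \bar R}.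
Proof.
by refine [the measure _ _ of pushforward (mu \x @lebesgue_measure R)%E (@consp n)];
  exact: measurable_consp.
Defined.

HB.instance Definition _ := Measure.copy (prod_lebesgue mu) nu.

End prod_lebesgue_measure.

(* The library has the Borel sigma-algebra on n.-tuple R but no Lebesgue measure
   there: it is the n-fold product of the one on R, transported at each step
   from R^n * R to R^(n+1). *)
Fixpoint lebesgue_Rn n : {measure set (n.-tuple R) -> \bar R} :=
  match n return {measure set (n.-tuple R) -> \bar R} with
  | 0 => \d_[tuple]
  | m.+1 => prod_lebesgue (lebesgue_Rn m)
  end.

Definition row_of_tuple n (t : n.-tuple R) : 'rV[R]_n := \row_i tnth t i.

Definition Linfty n (f : 'rV[R]_n -> R) : Prop :=
  f \o @row_of_tuple n \in Lfun (lebesgue_Rn n) +oo%E.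

(* integral over the torus R^n / Z^n, for f periodic, via the fundamental domain
   [0, 1[^n *)
Definition torus_integral n (f : 'rV[R]_n -> R) : R :=
  Rintegral (lebesgue_Rn n)
    [set t | forall i, 0 <= tnth t i < 1] (f \o @row_of_tuple n).

End lebesgue_measure_Rn.

(* (psi, c) is the pair (psi_A, c_A) attached to the data A, a, V *)
Definition cell_pair (R : realType) n (A : 'M[R]_n) (a : 'rV[R]_n)
    (V psi : 'rV[R]_n -> R) (c : R) : Prop :=
  [/\ smooth psi,
      Zn_periodic psi,
      torus_integral psi = 0,
      (forall x, \det (A + hessian psi x)
                 = expR (- dotv a (gradient psi x) + V x - c)) &
      forall x, sym_posdef (A + hessian psi x)].

(* Main.v *)
(* Write P_g = A + D^2 g.  Everything rests on the concavity of ln det, in the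
   form ln det Q - ln det P <= tr (P^-1 (Q - P)), used at maximum points.

   Drift.  With be = b - A a, f solves ln det P_f = - a.Df + be.x + V - c'.
   Since f = o(R^2), f - |x - R be|^2 has a local maximum x with x - R be = o(R)
   as R -> oo; there D^2 f <= 2 and Df = 2 (x - R be), so the left-hand side is
   bounded above while the right-hand side grows like R |be|^2 unless be = 0.

   Constant.  Compare P_f and P_psi at maxima of +-(f - psi) - eps |x|^2.

   Liouville.  Neither D^2 f nor the ellipticity of the operator linearised at
   f is controlled a priori.  However, L_f (psi - f) is, up to constants, at
   least tr (P_f^-1), so subtracting a multiple of f - psi from the usual Hopf
   exponent yields a barrier that works wherever tr (P_f^-1) is large, and where
   it is small the operator is uniformly elliptic.  This gives a strong maximum
   principle for the difference h - g of two solutions, in which balls of a fixed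
   radius r0 replace points (r0 = 0 when g = psi).  Let M and m be the
   supremum and the infimum of w = f - psi and suppose m < M.  Applied to
   f and psi it shows that w close to M at a point forces w close to M on any
   given ball around it; hence some integer vector k satisfies
   sup (f (. + k) - f) > M - m - eps.  Applied to f (. + k) and f, at a point x
   that almost realises this supremum, it gives a z within r0 of x + k which
   almost realises it too.  Then w is close to M at x + k and close to m at
   z, contradicting the first application. *)
Require Import Defs.
From HB Require Import structures.
From mathcomp Require Import all_boot all_order all_algebra.
From mathcomp Require Import all_classical all_reals all_analysis.
From mathcomp Require Import ess_sup_inf ring lra.

Import Order.TTheory GRing.Theory Num.Theory.
Import numFieldNormedType.Exports.

Local Open Scope classical_set_scope.
Local Open Scope ring_scope.

Set Implicit Arguments.
Unset Strict Implicit.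
Unset Printing Implicit Defensive.

(** * Euclidean inner product and quadratic forms *)

Lemma dotv_mul {R : realType} {n} (x y : 'rV[R]_n) : dotv x y = (x *m y^T) 0 0.
Proof. by rewrite mxE; apply: eq_bigr => i _; rewrite mxE. Qed.

Lemma dotvC {R : realType} {n} (x y : 'rV[R]_n) : dotv x y = dotv y x.
Proof. by apply: eq_bigr => i _; rewrite mulrC. Qed.

Lemma dotvDl {R : realType} {n} (x y z : 'rV[R]_n) :
  dotv (x + y) z = dotv x z + dotv y z.
Proof. by rewrite !dotv_mul mulmxDl mxE. Qed.

Lemma dotvZl {R : realType} {n} c (x z : 'rV[R]_n) : dotv (c *: x) z = c * dotv x z.
Proof. by rewrite !dotv_mul -scalemxAl mxE. Qed.

Lemma dotvDr {R : realType} {n} (x y z : 'rV[R]_n) :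
  dotv z (x + y) = dotv z x + dotv z y.
Proof. by rewrite ![dotv z _]dotvC dotvDl. Qed.

Lemma dotvZr {R : realType} {n} c (x z : 'rV[R]_n) : dotv z (c *: x) = c * dotv z x.
Proof. by rewrite ![dotv z _]dotvC dotvZl. Qed.

Lemma dotvNl {R : realType} {n} (x z : 'rV[R]_n) : dotv (- x) z = - dotv x z.
Proof. by rewrite -scaleN1r dotvZl mulN1r. Qed.

Lemma dotvNr {R : realType} {n} (x z : 'rV[R]_n) : dotv z (- x) = - dotv z x.
Proof. by rewrite dotvC dotvNl dotvC. Qed.

Lemma dot0v {R : realType} {n} (x : 'rV[R]_n) : dotv 0 x = 0.
Proof. by rewrite -(scale0r 0) dotvZl mul0r. Qed.

Lemma dotv0 {R : realType} {n} (x : 'rV[R]_n) : dotv x 0 = 0.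
Proof. by rewrite dotvC dot0v. Qed.

Lemma dotv_ge0 {R : realType} {n} (x : 'rV[R]_n) : 0 <= dotv x x.
Proof. by apply: sumr_ge0 => i _; rewrite -expr2 sqr_ge0. Qed.

Lemma dotv_eq0 {R : realType} {n} (x : 'rV[R]_n) : dotv x x = 0 -> x = 0.
Proof.
move=> /eqP; rewrite psumr_eq0; last by move=> i _; rewrite -expr2 sqr_ge0.
move=> /allP h; apply/rowP => i; rewrite mxE.
by have := h i (mem_index_enum _); rewrite mulf_eq0 orbb => /eqP.
Qed.

Lemma dotv_gt0 {R : realType} {n} (x : 'rV[R]_n) : x != 0 -> 0 < dotv x x.
Proof.
by move=> x0; rewrite lt_neqAle dotv_ge0 andbT eq_sym; apply: contra_neq x0 => /dotv_eq0.
Qed.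

(** Expand |s x + y|^2 and |s x - y|^2 and divide by s. The free weight s does the work of the
    Cauchy-Schwarz inequality without square roots. *)
Lemma dotv_young {R : realType} {n} (s : R) (x y : 'rV[R]_n) : 0 < s ->
  `|dotv x y| <= (s * dotv x x + s^-1 * dotv y y) / 2.
Proof.
move=> s0; have s1 : 0 <= s^-1 by rewrite invr_ge0 ltW.
have h1 := mulr_ge0 s1 (dotv_ge0 (s *: x + y)).
have h2 := mulr_ge0 s1 (dotv_ge0 (s *: x - y)).
have e1 : s^-1 * dotv (s *: x + y) (s *: x + y)
        = s * dotv x x + s^-1 * dotv y y + 2 * dotv x y.
  rewrite !(dotvDl, dotvDr, dotvZl, dotvZr) (dotvC y x).
  by field; rewrite gt_eqF.
have e2 : s^-1 * dotv (s *: x - y) (s *: x - y)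
        = s * dotv x x + s^-1 * dotv y y - 2 * dotv x y.
  rewrite !(dotvDl, dotvDr, dotvZl, dotvZr, dotvNl, dotvNr) (dotvC y x).
  by field; rewrite gt_eqF.
by move: h1 h2; rewrite e1 e2 ler_norml => h1 h2; apply/andP; split; lra.
Qed.

Lemma dotv_parallelogram {R : realType} {n} (x y : 'rV[R]_n) :
  dotv (x + y) (x + y) <= 2 * dotv x x + 2 * dotv y y.
Proof.
have := dotv_ge0 (x - y).
by rewrite !(dotvDl, dotvDr, dotvNl, dotvNr) (dotvC y x); lra.
Qed.

Lemma quad_formDl {R : realType} {n} (M N : 'M[R]_n) x :
  quad_form (M + N) x = quad_form M x + quad_form N x.
Proof. by rewrite /quad_form mulmxDr mulmxDl mxE. Qed.

Lemma quad_formZl {R : realType} {n} c (M : 'M[R]_n) x :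
  quad_form (c *: M) x = c * quad_form M x.
Proof. by rewrite /quad_form -scalemxAr -scalemxAl mxE. Qed.

Lemma quad_formNl {R : realType} {n} (M : 'M[R]_n) x :
  quad_form (- M) x = - quad_form M x.
Proof. by rewrite -scaleN1r quad_formZl mulN1r. Qed.

Lemma quad_form1 {R : realType} {n} (x : 'rV[R]_n) : quad_form 1%:M x = dotv x x.
Proof. by rewrite /quad_form mulmx1 dotv_mul. Qed.

Lemma quad_formZr {R : realType} {n} c (M : 'M[R]_n) x :
  quad_form M (c *: x) = c ^+ 2 * quad_form M x.
Proof. by rewrite /quad_form linearZ -!scalemxAl -scalemxAr !mxE; ring. Qed.

Lemma quad_form_rank1 {R : realType} {n} (x z : 'rV[R]_n) :
  quad_form (z^T *m z) x = dotv z x ^+ 2.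
Proof.
rewrite /quad_form mulmxA -mulmxA [x *m z^T]mx11_scalar [z *m x^T]mx11_scalar.
by rewrite -scalar_mxM mxE -!dotv_mul dotvC expr2.
Qed.

Lemma quad_form_congr {R : realType} {m n} (D : 'M[R]_(m, n)) (M : 'M[R]_n) x :
  quad_form (D *m M *m D^T) x = quad_form M (x *m D).
Proof. by rewrite /quad_form trmx_mul !mulmxA. Qed.

Lemma quad_form0r {R : realType} {n} (M : 'M[R]_n) : quad_form M 0 = 0.
Proof. by rewrite /quad_form !mul0mx mxE. Qed.

(** * Positive definite matrices and the concavity of ln det *)

Lemma sym_posdef_ge0 {R : realType} {n} (M : 'M[R]_n) x :
  sym_posdef M -> 0 <= quad_form M x.
Proof.
move=> [_ h]; have [->|/h/ltW//] := eqVneq x 0; by rewrite quad_form0r.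
Qed.

Lemma sym_posdef_congr {R : realType} {n} (D M : 'M[R]_n) :
  D \in unitmx -> sym_posdef M -> sym_posdef (D *m M *m D^T).
Proof.
move=> uD [sM pM]; split; first by rewrite !trmx_mul trmxK sM mulmxA.
move=> x x0; rewrite quad_form_congr; apply: pM; apply: contra_neq x0 => xD.
by rewrite -[x](mulmxK uD) xD mul0mx.
Qed.

Lemma quad_form_delta {R : realType} {n} (M : 'M[R]_n) i :
  quad_form M (delta_mx 0 i) = M i i.
Proof. by rewrite /quad_form -rowE trmx_delta -colE !mxE. Qed.

Lemma posdef_diag_gt0 {R : realType} {n} (M : 'M[R]_n) i :
  sym_posdef M -> 0 < M i i.
Proof.
move=> [_ pM]; rewrite -quad_form_delta; apply: pM; apply/eqP => /matrixP /(_ 0 i).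
by rewrite !mxE !eqxx => /eqP; rewrite oner_eq0.
Qed.

(** [S] is the Schur complement of the corner [p]: its form at y is the form of P at the row ending
    in y whose first entry completes the square. This peels off one coordinate in inductions on
    n. *)
Lemma sym_posdef_split {R : realType} {n} (P : 'M[R]_(1 + n)) : sym_posdef P ->
  exists p v S, [/\ 0 < p, sym_posdef S &
    P = block_mx p%:M v v^T (S + p^-1 *: (v^T *m v))].
Proof.
move=> pP; have p0 := posdef_diag_gt0 0 pP; move: pP => [sP pP].
set p := P 0 0 in p0; pose v : 'M[R]_(1, n) := ursubmx P.
exists p, v, (drsubmx P - p^-1 *: (v^T *m v)).
have eP : P = block_mx p%:M v v^T (drsubmx P).
  rewrite -[LHS](@submxK _ 1 n 1 n); congr block_mx.
    by rewrite [LHS]mx11_scalar !mxE; congr (P _ _)%:M; apply: val_inj.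
  by rewrite /v trmx_ursub sP.
split=> //; last by rewrite subrK.
have sD : (drsubmx P)^T = drsubmx P by rewrite -[in RHS]sP trmx_drsub.
split; first by rewrite linearB /= linearZ /= trmx_mul trmxK sD.
move=> y y0.
have -> : quad_form (drsubmx P - p^-1 *: (v^T *m v)) y
        = quad_form P (row_mx (- p^-1 *: (y *m v^T)) y).
  rewrite [in RHS]eP /quad_form mul_row_block tr_row_mx mul_row_col.
  rewrite [y *m v^T]mx11_scalar; set c := (y *m v^T) 0 0.
  have ev : (v *m y^T) = c%:M.
    by rewrite -[LHS]trmxK trmx_mul trmxK [y *m _]mx11_scalar tr_scalar_mx.
  rewrite mulmxBr mulmxBl -scalemxAr -scalemxAl mulmxA -[_ *m v *m _]mulmxA ev.
  rewrite [y *m v^T]mx11_scalar -/c !linearZ /= !tr_scalar_mx mulmxDl mulmxDl.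
  rewrite -[_ *m v *m y^T]mulmxA ev -!scalemxAl -!scalar_mxM !mxE eqxx !mulr1n.
  by field; rewrite gt_eqF.
apply: pP; apply: contra_neq y0 => e.
by rewrite -[y](@row_mxKr _ 1 1 n (- p^-1 *: (y *m v^T)) y) e linear0.
Qed.

(** Cholesky factorisation, by induction through the Schur complement. *)
Lemma sym_posdef_factor {R : realType} {n} (P : 'M[R]_n) : sym_posdef P ->
  exists2 D, D \in unitmx & P = D *m D^T.
Proof.
elim: n P => [|n IH] P; first by exists 1%:M; rewrite ?unitmx1// [LHS]flatmx0 [RHS]flatmx0.
move=> /(@sym_posdef_split _ n)[p [v [S [p0 /IH[E uE ->] ->]]]].
pose s := Num.sqrt p; have s0 : 0 < s by rewrite sqrtr_gt0.
have ss : s * s = p by rewrite -expr2 sqr_sqrtr// ltW.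
exists (block_mx s%:M 0 (s^-1 *: v^T) E).
  rewrite unitmxE (@det_lblock _ 1 n) det_scalar1 unitfE mulf_neq0//.
    by rewrite gt_eqF.
  by rewrite -unitfE -unitmxE.
rewrite (@tr_block_mx _ 1 n 1 n) (@mulmx_block _ 1 n 1 n 1 n) !trmx0 !mul0mx !mulmx0 !addr0.
have -> : (s^-1 *: v^T)^T = s^-1 *: v by rewrite linearZ /= trmxK.
rewrite tr_scalar_mx -scalar_mxM ss.
rewrite -!scalemxAr -!scalemxAl mul_scalar_mx mul_mx_scalar !scalerA.
rewrite mulVf ?gt_eqF// ?mulfV ?gt_eqF// !scale1r -invfM ss.
by rewrite [E *m _ + _]addrC.
Qed.

Lemma sym_posdef_det_gt0 {R : realType} {n} (P : 'M[R]_n) :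
  sym_posdef P -> 0 < \det P.
Proof.
move=> /sym_posdef_factor[D]; rewrite unitmxE unitfE => D0 ->.
by rewrite det_mulmx det_tr -expr2 exprn_even_gt0 //= D0.
Qed.

Lemma sym_posdef_unitmx {R : realType} {n} (P : 'M[R]_n) :
  sym_posdef P -> P \in unitmx.
Proof. by move=> /sym_posdef_det_gt0; rewrite unitmxE unitfE => /gt_eqF ->. Qed.

Lemma sym_posdef_invmx {R : realType} {n} (P : 'M[R]_n) :
  sym_posdef P -> sym_posdef (invmx P).
Proof.
move=> pP; have uP := sym_posdef_unitmx pP.
have uV : invmx P \in unitmx by rewrite unitmx_inv.
have := sym_posdef_congr uV pP.
by rewrite mulVmx// mul1mx trmx_inv; case: pP => ->.
Qed.

Lemma ln_le_subr1 {R : realType} (x : R) : 0 < x -> ln x <= x - 1.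
Proof. by move=> x0; rewrite -{1}[x](subrKC 1); apply: le_ln1Dx; lra. Qed.

(* Hadamard's inequality followed by ln x <= x - 1 *)
Lemma ln_det_le_mxtrace {R : realType} {n} (P : 'M[R]_n) :
  sym_posdef P -> ln (\det P) <= \tr P - n%:R.
Proof.
elim: n P => [|n IH] P; first by move=> _; rewrite det_mx00 ln1 /mxtrace big_ord0 subrr.
move=> /(@sym_posdef_split _ n)[p [v [S [p0 pS ->]]]].
have -> : block_mx p%:M v v^T (S + p^-1 *: (v^T *m v)) =
    block_mx 1%:M 0 (p^-1 *: v^T) 1%:M *m block_mx p%:M v 0 S.
  rewrite (@mulmx_block _ 1 n 1 n 1 n) !mul1mx !mul0mx ?mulmx0 !addr0.
  rewrite -!scalemxAl mul_mx_scalar scalerA mulVf ?gt_eqF// scale1r.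
  by rewrite [S + _]addrC.
rewrite det_mulmx (@det_lblock _ 1 n) (@det_ublock _ 1 n) !det1 !mul1r det_scalar1.
rewrite lnM ?posrE ?sym_posdef_det_gt0//.
rewrite (@mulmx_block _ 1 n 1 n 1 n) (@mxtrace_block _ 1 n).
rewrite !mul1mx !mul0mx !addr0 mxtraceD -scalemxAl mxtraceZ mxtrace_mulC.
rewrite mxtrace_scalar mulr1n.
have vv : 0 <= \tr (v *m v^T).
  by rewrite [_ *m _]mx11_scalar mxtrace_scalar -dotv_mul dotv_ge0.
have := mulr_ge0 _ vv; move=> /(_ p^-1); rewrite invr_ge0 ltW// => /(_ isT) h.
by have := IH _ pS; have := ln_le_subr1 p0; rewrite -natr1; lra.
Qed.

(** For P = D D^T the trace is the sum of the values of the form S on the columns of D. *)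
Lemma mxtrace_mul_ge0 {R : realType} {n} (P S : 'M[R]_n) : sym_posdef P ->
  (forall x, 0 <= quad_form S x) -> 0 <= \tr (P *m S).
Proof.
move=> /sym_posdef_factor[D _ ->] pS.
rewrite -mulmxA mxtrace_mulC; apply: sumr_ge0 => i _.
have := pS (row i D^T); rewrite rowE -(quad_form_congr D^T) trmxK quad_form_delta.
by [].
Qed.

(** P Q need not be symmetric, but for P = D D^T the matrix D^T Q D is, and it has the same trace
    and determinant; [ln_det_le_mxtrace] applies to it. *)
Lemma ln_det_mul_le {R : realType} {n} (P Q : 'M[R]_n) :
  sym_posdef P -> sym_posdef Q ->
  ln (\det P) + ln (\det Q) <= \tr (P *m Q) - n%:R.
Proof.
move=> pP pQ; rewrite -lnM ?posrE ?sym_posdef_det_gt0//.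
have [D uD ->] := sym_posdef_factor pP.
rewrite -mulmxA mxtrace_mulC.
have uT : D^T \in unitmx by rewrite unitmx_tr.
have := ln_det_le_mxtrace (sym_posdef_congr uT pQ).
by rewrite trmxK !det_mulmx mulrAC [X in ln X](_ : _ = \det D * \det D^T * \det Q) //; ring.
Qed.

Lemma ln_det_concave {R : realType} {n} (P Q : 'M[R]_n) :
  sym_posdef P -> sym_posdef Q ->
  ln (\det Q) - ln (\det P) <= \tr (invmx P *m (Q - P)).
Proof.
move=> pP pQ; have := ln_det_mul_le (sym_posdef_invmx pP) pQ.
rewrite det_inv lnV ?posrE ?sym_posdef_det_gt0// mulmxBr mulVmx ?sym_posdef_unitmx//.
by rewrite linearB /= mxtrace1; lra.
Qed.

Lemma ln_det_mono {R : realType} {n} (P Q : 'M[R]_n) :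
  sym_posdef P -> sym_posdef Q -> (forall x, quad_form Q x <= quad_form P x) ->
  ln (\det Q) <= ln (\det P).
Proof.
move=> pP pQ h; have := ln_det_concave pP pQ.
have : 0 <= \tr (invmx P *m (P - Q)).
  apply: mxtrace_mul_ge0 (sym_posdef_invmx pP) _ => x.
  by rewrite quad_formDl quad_formNl subr_ge0.
by rewrite -opprB mulmxN linearN /=; lra.
Qed.

Lemma sym_posdefD {R : realType} {n} (P Q : 'M[R]_n) : sym_posdef P ->
  Q^T = Q -> (forall x, 0 <= quad_form Q x) -> sym_posdef (P + Q).
Proof.
move=> [sP pP] sQ pQ; split; first by rewrite linearD /= sP sQ.
by move=> x x0; rewrite quad_formDl ltr_wpDr// pP.
Qed.

Lemma sym_posdefZ {R : realType} {n} c (P : 'M[R]_n) : 0 < c -> sym_posdef P ->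
  sym_posdef (c *: P).
Proof.
move=> c0 [sP pP]; split; first by rewrite linearZ /= sP.
by move=> x x0; rewrite quad_formZl mulr_gt0// pP.
Qed.

Lemma sym_posdef1 {R : realType} {n} : @sym_posdef R n 1%:M.
Proof. by split; [rewrite trmx1|move=> x x0; rewrite quad_form1 dotv_gt0]. Qed.

(** One bordered matrix is factored into block triangular matrices in two ways. *)
Lemma det_1D_rank1 {R : realType} {n} s (z : 'rV[R]_n) :
  \det (1%:M + s *: (z^T *m z)) = 1 + s * dotv z z.
Proof.
have e1 : block_mx 1%:M (- s *: z) z^T 1%:M =
    block_mx 1%:M 0 z^T 1%:M *m block_mx 1%:M (- s *: z) 0 (1%:M + s *: (z^T *m z)).
  rewrite mulmx_block !mul1mx !mul0mx !mulmx1 !addr0 !scaleNr mulmxN -scalemxAr.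
  by rewrite addrCA addNr addr0.
have e2 : block_mx 1%:M (- s *: z) z^T 1%:M =
    block_mx (1%:M + s *: (z *m z^T)) (- s *: z) 0 1%:M *m block_mx 1%:M 0 z^T 1%:M.
  rewrite mulmx_block !mul1mx !mul0mx !mulmx1 !mulmx0 !add0r !scaleNr mulNmx -scalemxAl.
  by rewrite addrK.
have := congr1 (@determinant _ _) e1; rewrite e2 !det_mulmx !det_lblock !det_ublock.
rewrite !det1 !mulr1 !mul1r => <-.
by rewrite det_mx11 dotv_mul mxE [X in X + _ = _]mxE [X in _ + X = _]mxE.
Qed.

(* Pairing N with 1 + s z^T z in ln_det_mul_le gains ln (1 + s), which beats the
   loss from the upper bound on the trace as s grows. *)
Lemma sym_posdef_lower_bound {R : realType} n (t d : R) : exists2 mu, 0 < mu &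
  forall N : 'M[R]_n, sym_posdef N -> \tr N <= t -> - d <= ln (\det N) ->
  forall z, mu * dotv z z <= quad_form N z.
Proof.
pose e := expR (`|t| + `|d| + 1); have e1 : 1 < e by rewrite expR_gt1; have:= normr_ge0 t; have := normr_ge0 d; lra.
exists (e - 1)^-1; first by rewrite invr_gt0; lra.
move=> N pN tN dN z; have [->|z0] := eqVneq z 0; first by rewrite dotv0 mulr0 quad_form0r.
have zz := dotv_gt0 z0.
(* With this s the determinant 1 + s |z|^2 equals e, whose logarithm absorbs both t and d and leaves
   1 to spare. *)
pose s := (e - 1) / dotv z z; have s0 : 0 < s by rewrite divr_gt0//; lra.
have pW : sym_posdef (1%:M + s *: (z^T *m z)).
  apply: sym_posdefD sym_posdef1 _ _; first by rewrite linearZ /= trmx_mul trmxK.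
  by move=> x; rewrite quad_formZl quad_form_rank1 mulr_ge0 ?sqr_ge0// ltW.
have := ln_det_mul_le pW pN.
rewrite det_1D_rank1 divfK ?gt_eqF// subrKC expRK.
rewrite mulmxDl mul1mx mxtraceD -scalemxAl mxtraceZ -mulmxA mxtrace_mulC.
rewrite [_ *m z^T]mx11_scalar mxtrace_scalar mulr1n -/(quad_form N z).
have := ler_norm t; have := ler_norm d; have : 0 <= n%:R :> R by [].
move=> h1 h2 h3 h4; have {h1 h2 h3 h4} : 1 <= s * quad_form N z by lra.
rewrite /s mulrAC ler_pdivlMr// mul1r => h.
by rewrite mulrC ler_pdivrMr ?[_ * (e - 1)]mulrC//; lra.
Qed.

(** * Directional derivatives, gradient and Hessian *)

(** A derivative depends only on the increments of the function, so it can be carried between a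
    space, its lines and its translates. *)
Lemma is_derive_quotient {R : realType} (U V : normedModType R)
    (F : U -> R) (G : V -> R) x y v w d :
  (forall h : R, F (h *: v + x) - F x = G (h *: w + y) - G y) ->
  is_derive x v F d -> is_derive y w G d.
Proof.
move=> e dF; have e2 : (fun h : R => h^-1 *: ((F \o shift x) (h *: v) - F x)) =
    (fun h => h^-1 *: ((G \o shift y) (h *: w) - G y)).
  by apply/funext => h /=; rewrite e.
by apply: DeriveDef; [rewrite /derivable -e2; exact: ex_derive|
  rewrite /derive -e2; exact: derive_val].
Qed.

Lemma is_derive_line {R : realType} (V : normedModType R) (F : V -> R) x v t d :
  is_derive (x + t *: v) v F d -> is_derive t 1 (fun s : R => F (x + s *: v)) d.
Proof.
apply: is_derive_quotient => h; congr (F _ - _).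
by rewrite [h%:A]mulr1 scalerDl addrCA.
Qed.

Lemma is_derive_of_line {R : realType} (V : normedModType R) (F : V -> R) x v d :
  is_derive (0 : R) 1 (fun s : R => F (x + s *: v)) d -> is_derive x v F d.
Proof.
apply: is_derive_quotient => h.
by rewrite [h%:A]mulr1 addr0 scale0r addr0 [x + _]addrC.
Qed.

Lemma is_derive_shift_arg {R : realType} (V : normedModType R) (F : V -> R) k x v d :
  is_derive (x + k) v F d -> is_derive x v (fun y => F (y + k)) d.
Proof. by apply: is_derive_quotient => h; rewrite addrA. Qed.

Lemma mean_value_0 {R : realType} (f df : R -> R) (s : R) :
  (forall t : R, is_derive t (1 : R) f (df t)) ->
  exists2 c, `|c| <= `|s| & f s - f 0 = df c * s.
Proof.
move=> h.
have cf a b : {within `[a, b], continuous f}.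
  apply: derivable_within_continuous => t _; exact: ex_derive.
have [s0|s0] := leP 0 s.
  have [c + e] := MVT_segment s0 (fun t _ => h t) (cf _ _).
  rewrite in_itv /= => /andP[c0 cs]; exists c; last by rewrite e subr0.
  by rewrite !ger0_norm.
have [c + e] := MVT_segment (ltW s0) (fun t _ => h t) (cf _ _).
rewrite in_itv /= => /andP[c0 cs]; exists c; last by rewrite -opprB e; ring.
by rewrite (ler0_norm cs) (ler0_norm (ltW s0)) lerN2.
Qed.

(** The increment along v + c e_i is the one along v plus a step in a coordinate direction; the mean
    value theorem and the continuity of the i-th partial derivative handle the latter. *)
Lemma is_derive_add_partial {R : realType} {n} (F : 'rV[R]_n -> R) i x v d (c : R) :
  (forall y, derivable F y (delta_mx 0 i)) -> {for x, continuous (partial i F)} ->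
  is_derive x v F d -> is_derive x (v + c *: delta_mx 0 i) F (d + c * partial i F x).
Proof.
move=> dF cF dv; set e := delta_mx 0 i in dF *.
pose g (h : R) := h^-1 *: (F (h *: (v + c *: e) + x) - F (h *: v + x)).
have gl : g h @[h --> 0^'] --> c * partial i F x.
  apply/cvgrPdist_le => /= eps eps0.
  have c1 : 0 < `|c| + 1 by rewrite ltr_wpDl.
  have := cF; move=> /cvgrPdist_le /(_ (eps / (`|c| + 1))).
  rewrite divr_gt0// => /(_ isT) /nbhs_ballP[del /= del0 hdel].
  have K0 : 0 < `|v| + `|c| * `|e| + 1 by rewrite ltr_wpDl// addr_ge0// mulr_ge0.
  near=> h.
  have h0 : h != 0 by near: h; exact: nbhs_dnbhs_neq.
  have hs : `|h| < del / (`|v| + `|c| * `|e| + 1).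
    by near: h; apply: dnbhs0_lt; exact: divr_gt0.
  have [xi xile E] := @mean_value_0 R (fun s => F (h *: v + x + s *: e)) 
     (fun s => partial i F (h *: v + x + s *: e)) (h * c)
     (fun t => is_derive_line (derivableP (dF (h *: v + x + t *: e)))).
  have -> : g h = c * partial i F (h *: v + x + xi *: e).
    have -> : g h = h^-1 * (F (h *: v + x + (h * c) *: e) - F (h *: v + x + 0 *: e)).
      by rewrite /g [h *: (v + _)]scalerDr addrAC scalerA scale0r addr0.
    by rewrite E; field.
  rewrite -mulrBr normrM.
  have : `|partial i F x - partial i F (h *: v + x + xi *: e)| <= eps / (`|c| + 1).
    apply: hdel; rewrite -ball_normE /ball_ /=.
    rewrite [_ *: v + x]addrC -addrA opprD addrA subrr add0r normrN.
    apply: le_lt_trans (ler_normD _ _) _; rewrite !normrZ.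
    apply: (@le_lt_trans _ _ (`|h| * (`|v| + `|c| * `|e| + 1))); last by rewrite -ltr_pdivlMr.
    rewrite !mulrDr mulr1 -addrA lerD2l ler_wpDr// mulrA ler_wpM2r//.
    by rewrite -normrM.
  rewrite ler_pdivlMr// => H; apply: le_trans H; rewrite mulrC ler_wpM2l//.
  by rewrite lerDl.
have dl : (fun h : R => h^-1 *: ((F \o shift x) (h *: v) - F x)) @ 0^' --> d.
  by case: dv => dv <-.
have H : h^-1 *: ((F \o shift x) (h *: (v + c *: e)) - F x) @[h --> 0^'] -->
    d + c * partial i F x.
  apply: cvg_trans (cvgD dl gl); apply: near_eq_cvg; near=> h.
  by rewrite fctE /g /= -scalerDr addrC addrA subrK.
apply: DeriveDef; first by apply/cvg_ex; exists (d + c * partial i F x).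
exact: cvg_lim H.
Unshelve. all: by end_near. Qed.

(** Start from the zero direction and add the coordinates of v one at a time. *)
Lemma is_derive_gradient {R : realType} {n} (F : 'rV[R]_n -> R) x v :
  (forall y i, derivable F y (delta_mx 0 i)) ->
  (forall i, {for x, continuous (partial i F)}) ->
  is_derive x v F (dotv (gradient F x) v).
Proof.
move=> dF cF; rewrite {1}[v]row_sum_delta.
have -> : dotv (gradient F x) v = \sum_i (v 0 i * partial i F x).
  by apply: eq_bigr => i _; rewrite mxE mulrC.
elim/big_rec2: _ => [|i y1 y2 _ IH]; first exact: is_derive0.
by rewrite [_ *: _ + _]addrC [_ * _ + _]addrC; apply: is_derive_add_partial.
Qed.

(* G and H are the gradient and Hessian fields of F, in the form in which
   restrictions to lines see them. *)
Definition twice_derivable {R : realType} {n} (F : 'rV[R]_n -> R)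
    (G : 'rV[R]_n -> 'rV[R]_n) (H : 'rV[R]_n -> 'M[R]_n) : Prop :=
  [/\ continuous F,
      forall x v, is_derive x v F (dotv (G x) v) &
      forall x v, is_derive x v (fun y => dotv (G y) v) (quad_form (H x) v)].

Lemma quad_form_sum {R : realType} {n} (M : 'M[R]_n) x :
  quad_form M x = \sum_i \sum_j x 0 i * M i j * x 0 j.
Proof.
rewrite /quad_form mxE exchange_big; apply: eq_bigr => j _.
by rewrite !mxE mulr_suml; apply: eq_bigr.
Qed.

Lemma smooth_twice_derivable {R : realType} {n} (F : 'rV[R]_n -> R) :
  smooth F -> twice_derivable F (gradient F) (hessian F).
Proof.
move=> sF; split=> [|x v|x v]; first exact: (sF [::]).1.
- apply: is_derive_gradient => [y i|i]; first exact: (sF [::]).2.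
  by have [h _] := sF [:: i]; exact: h.
- have -> : (fun y => dotv (gradient F y) v) = \sum_(i < n) (v 0 i \*: partial i F).
    apply/funext => y; rewrite fct_sumE; apply: eq_bigr => i _.
    by rewrite mxE mulrC.
  have -> : quad_form (hessian F x) v =
      \sum_(i < n) v 0 i *: dotv (gradient (partial i F) x) v.
    rewrite quad_form_sum exchange_big; apply: eq_bigr => i _.
    rewrite /GRing.scale /= /dotv mulr_sumr; apply: eq_bigr => j _.
    by rewrite !mxE; ring.
  apply: is_derive_sum => i; apply: is_deriveZ.
  apply: is_derive_gradient => [y j|j]; first exact: (sF [:: i]).2.
  by have [h _] := sF [:: j; i]; exact: h.
Qed.

Section continuity.
Context {R : realType} {T : topologicalType}.
Implicit Types F : T -> R.

Lemma continuous_add F F' : continuous F -> continuous F' ->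
  continuous (fun x => F x + F' x).
Proof. by move=> cF cF' x; exact: (continuousD (cF x) (cF' x)). Qed.

Lemma continuous_mul F F' : continuous F -> continuous F' ->
  continuous (fun x => F x * F' x).
Proof. by move=> cF cF' x; exact: (continuousM (cF x) (cF' x)). Qed.

Lemma continuous_sum I (s : seq I) (F : I -> T -> R) :
  (forall i, continuous (F i)) -> continuous (fun x => \sum_(i <- s) F i x).
Proof.
move=> cF; elim: s => [|i s IH].
  by under eq_fun do rewrite big_nil; move=> x; exact: cst_continuous.
by under eq_fun do rewrite big_cons; exact: continuous_add.
Qed.

Lemma continuous_cst (c : R) : continuous (fun _ : T => c).
Proof. by move=> x; exact: cst_continuous. Qed.

End continuity.

Lemma continuous_compose (S T U : topologicalType) (f : S -> T) (g : T -> U) :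
  continuous f -> continuous g -> continuous (fun x => g (f x)).
Proof. by move=> cf cg x; exact: (continuous_comp (cf x) (cg (f x))). Qed.

Lemma continuous_shift {R : realType} (V : normedModType R) (k : V) :
  continuous (fun x : V => x + k).
Proof. by move=> x; apply: cvgD; [exact: cvg_id|exact: cvg_cst]. Qed.

(** * Calculus rules for gradient and Hessian fields *)

Section twice_derivable_closure.
Context {R : realType} {n : nat}.
Implicit Types (F : 'rV[R]_n -> R) (G : 'rV[R]_n -> 'rV[R]_n) (H : 'rV[R]_n -> 'M[R]_n).

Lemma twice_derivableD F G H F' G' H' :
  twice_derivable F G H -> twice_derivable F' G' H' ->
  twice_derivable (fun x => F x + F' x) (fun x => G x + G' x) (fun x => H x + H' x).
Proof.
move=> [cF dF ddF] [cF' dF' ddF']; split=> [|x v|x v].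
- exact: continuous_add.
- by rewrite dotvDl; exact: is_deriveD.
- rewrite quad_formDl; under eq_fun do rewrite dotvDl; exact: is_deriveD.
Qed.

Lemma twice_derivableZ c F G H : twice_derivable F G H ->
  twice_derivable (fun x => c * F x) (fun x => c *: G x) (fun x => c *: H x).
Proof.
move=> [cF dF ddF]; split=> [|x v|x v].
- by apply: continuous_mul; first exact: continuous_cst.
- by rewrite dotvZl; exact: is_deriveZ.
- rewrite quad_formZl; under eq_fun do rewrite dotvZl; exact: is_deriveZ.
Qed.

Lemma twice_derivableB F G H F' G' H' :
  twice_derivable F G H -> twice_derivable F' G' H' ->
  twice_derivable (fun x => F x - F' x) (fun x => G x - G' x) (fun x => H x - H' x).
Proof.
move=> [cF dF ddF] [cF' dF' ddF']; split=> [x|x v|x v].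
- exact: (continuousB (cF x) (cF' x)).
- by rewrite dotvDl dotvNl; exact: is_deriveB.
- rewrite quad_formDl quad_formNl; under eq_fun do rewrite dotvDl dotvNl.
  exact: is_deriveB.
Qed.

Lemma twice_derivable_shift k F G H : twice_derivable F G H ->
  twice_derivable (fun x => F (x + k)) (fun x => G (x + k)) (fun x => H (x + k)).
Proof.
move=> [cF dF ddF]; split=> [|x v|x v].
- by apply: continuous_compose cF; exact: continuous_shift.
- exact: is_derive_shift_arg.
- exact: (is_derive_shift_arg (F := fun y => dotv (G y) v)).
Qed.

Lemma is_derive_expR_comp F x v d : is_derive x v F d ->
  is_derive x v (fun y => expR (F y)) (expR (F x) * d).
Proof.
move=> dF; apply: is_derive_of_line.
have dl : is_derive (0 : R) 1 (fun s : R => F (x + s *: v)) d.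
  by apply: is_derive_line; rewrite scale0r addr0.
have h := is_derive_expR (F (x + (0 : R) *: v)).
have := is_derive1_comp (f := expR) (g := fun s : R => F (x + s *: v)) h dl.
by rewrite scale0r addr0.
Qed.

Lemma twice_derivable_expR F G H : twice_derivable F G H ->
  twice_derivable (fun x => expR (F x)) (fun x => expR (F x) *: G x)
    (fun x => expR (F x) *: (H x + (G x)^T *m G x)).
Proof.
move=> [cF dF ddF]; split=> [|x v|x v].
- by apply: continuous_compose cF _; exact: continuous_expR.
- by rewrite dotvZl; exact: is_derive_expR_comp.
- under eq_fun do rewrite dotvZl.
  apply: is_derive_eq (is_deriveM (is_derive_expR_comp (dF x v)) (ddF x v)) _.
  rewrite quad_formZl quad_formDl quad_form_rank1 /GRing.scale /=; ring.
Qed.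

Lemma is_derive_dotv (l x v : 'rV[R]_n) : is_derive x v (fun y => dotv y l) (dotv v l).
Proof.
apply: is_derive_of_line; under eq_fun do rewrite dotvDl dotvZl.
have -> : (fun s : R => dotv x l + s * dotv v l) = cst (dotv x l) + (dotv v l \*: id).
  by apply/funext => s; rewrite fctE /= mulrC.
by apply: is_derive_eq; rewrite add0r /GRing.scale /= mulr1.
Qed.

Lemma continuous_dotv (l : 'rV[R]_n) : continuous (fun y => dotv y l).
Proof.
apply: continuous_sum => i; apply: continuous_mul; last exact: continuous_cst.
by move=> x; exact: coord_continuous.
Qed.

Lemma twice_derivable_dotv (l : 'rV[R]_n) :
  twice_derivable (dotv l) (fun=> l) (fun=> 0).
Proof.
have e : dotv l = (fun y => dotv y l) by apply/funext => y; rewrite dotvC.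
split=> [|x v|x v].
- by rewrite e; exact: continuous_dotv.
- by rewrite e; exact: is_derive_dotv.
- by rewrite -[X in quad_form X](scale0r 1%:M) quad_formZl mul0r; exact: is_derive_cst.
Qed.

Lemma twice_derivable_quad_form (A : 'M[R]_n) : A^T = A ->
  twice_derivable (fun x => 2^-1 * quad_form A x) (fun x => x *m A) (fun=> A).
Proof.
move=> sA.
(* This exact expansion makes the function a quadratic polynomial on each line. *)
have e x v : quad_form A (x + v) = quad_form A x + 2 * dotv (x *m A) v + quad_form A v.
  have sym : dotv (v *m A) x = dotv (x *m A) v.
    by rewrite dotvC !dotv_mul trmx_mul sA mulmxA.
  by rewrite /quad_form -!dotv_mul mulmxDl !(dotvDl, dotvDr) sym; ring.
split=> [|x v|x v].
- apply: continuous_mul; first exact: continuous_cst.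
  rewrite (funext (quad_form_sum A)).
  do 2 (apply: continuous_sum => ?).
  do 2? apply: continuous_mul; try exact: continuous_cst.
    by move=> x; exact: coord_continuous.
  by move=> x; exact: coord_continuous.
- apply: is_derive_of_line.
  have -> : (fun s : R => 2^-1 * quad_form A (x + s *: v)) =
     cst (2^-1 * quad_form A x) + (dotv (x *m A) v \*: id) +
     ((2^-1 * quad_form A v) \*: (id * id)).
    apply/funext => s; rewrite e quad_formZr dotvZr !fctE /= /GRing.scale /=.
    by field.
  apply: is_derive_eq; rewrite /GRing.scale /=; ring.
- have -> : (fun y => dotv (y *m A) v) = (fun y => dotv y (v *m A)).
    by apply/funext => y; rewrite !dotv_mul trmx_mul sA mulmxA.
  have -> : quad_form A v = dotv v (v *m A); last exact: is_derive_dotv.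
  by rewrite dotvC dotv_mul.
Qed.

Lemma twice_derivable_sqdist (y : 'rV[R]_n) :
  twice_derivable (fun x => dotv (x - y) (x - y)) (fun x => 2 *: (x - y)) (fun=> 2 *: 1%:M).
Proof.
have := @twice_derivable_quad_form 1%:M; rewrite trmx1 => /(_ erefl).
move=> /(twice_derivableZ 2) /(twice_derivable_shift (- y)).
have -> // : (fun x : 'rV[R]_n => 2 * (2^-1 * quad_form 1%:M (x - y))) =
  (fun x => dotv (x - y) (x - y)).
  by apply/funext => x; rewrite quad_form1; field.
by have -> // : (fun x : 'rV[R]_n => 2 *: ((x - y) *m 1%:M)) =
  (fun x => 2 *: (x - y)); apply/funext => x; rewrite mulmx1.
Qed.

End twice_derivable_closure.

(** * First and second order conditions at a maximum *)

Lemma second_derivative_at_max {R : realType} (f df : R -> R) d e : 0 < e ->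
  (forall t : R, is_derive t (1 : R) f (df t)) -> is_derive (0 : R) (1 : R) df d ->
  (forall t, `|t| < e -> f t <= f 0) -> df 0 = 0 /\ d <= 0.
Proof.
move=> e0 dfE ddf mx.
have [_ df0] : is_derive (0 : R) (1 : R) f 0.
  apply: (@derive1_at_max R f (- e) e 0); rewrite ?in_itv /=.
  - lra.
  - by move=> t _; exact: ex_derive.
  - lra.
  - by move=> t; rewrite in_itv /= -ltr_norml; exact: mx.
have [_ df0'] := dfE 0; split; first by rewrite -df0' df0.
(* If d > 0, then df is positive just to the right of 0, and the mean value theorem makes f exceed f
   0 there. *)
rewrite leNgt; apply/negP => d0.
have cv : h^-1 *: ((df \o shift 0) (h *: 1) - df 0) @[h --> 0^'] --> d.
  by case: ddf => ddf <-.
have : \forall h \near 0^', 0 < h^-1 *: ((df \o shift 0) (h *: 1) - df 0).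
  by apply: cvgr_gt d0; exact: cv.
rewrite near_withinE => /nbhs_ballP[r /= r0 hr].
pose h := Num.min r e / 2.
have m0 : 0 < Num.min r e by rewrite lt_min r0.
have hr2 : h < r by have : Num.min r e <= r by [rewrite ge_min lexx]; rewrite /h; lra.
have he : h < e by have : Num.min r e <= e by [rewrite ge_min lexx orbT]; rewrite /h; lra.
have h0 : 0 < h by rewrite /h; lra.
have [c] := MVT h0 (fun t _ => dfE t) (derivable_within_continuous (fun t _ => ex_derive (is_derive := dfE t))).
rewrite in_itv /= => /andP[c0 ch] E.
have : 0 < c^-1 *: ((df \o shift 0) (c *: 1) - df 0).
  apply: hr; last by rewrite gt_eqF.
  by rewrite -ball_normE /ball_ /= sub0r normrN gtr0_norm// (lt_trans ch).
rewrite /= addr0 -df0' df0 subr0 [c%:A]mulr1 /GRing.scale /= pmulr_rgt0 ?invr_gt0// => dc.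
have := mx h; rewrite gtr0_norm// => /(_ he).
have : 0 < df c * (h - 0) by rewrite subr0 mulr_gt0.
lra.
Qed.

Section annulus.
Context {R : realType} {n : nat}.
Implicit Types (F : 'rV[R]_n -> R) (G : 'rV[R]_n -> 'rV[R]_n) (H : 'rV[R]_n -> 'M[R]_n).

Lemma continuous_sqdist (y : 'rV[R]_n) : continuous (fun x : 'rV[R]_n => dotv (x - y) (x - y)).
Proof. by have [] := twice_derivable_sqdist y. Qed.

Lemma compact_annulus (y : 'rV[R]_n) (s1 s2 : R) :
  compact [set x : 'rV[R]_n | s1 <= dotv (x - y) (x - y) <= s2].
Proof.
(* The half-width 1 + |s2| dominates the square root of |s2|. *)
pose box := [set x : 'rV[R]_n | forall i, x ord0 i \in `[y ord0 i - (1 + `|s2|), y ord0 i + (1 + `|s2|)]].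
have cbox : compact box.
  apply: (@rV_compact _ _ (fun i => `[y ord0 i - (1 + `|s2|), y ord0 i + (1 + `|s2|)]%classic)).
  by move=> i; apply: segment_compact.
apply: subclosed_compact cbox _.
- have -> : [set x | s1 <= dotv (x - y) (x - y) <= s2] =
      (fun x : 'rV[R]_n => dotv (x - y) (x - y)) @^-1` `[s1, s2]%classic.
    by apply/seteqP; split=> x /=; rewrite in_itv.
  apply: closed_comp; last exact: interval_closed.
  by move=> x _; exact: continuous_sqdist.
- move=> x /= /andP[_ xs] i; rewrite in_itv /=.
  have : (x 0 i - y 0 i) ^+ 2 <= `|s2|.
    apply: le_trans (ler_norm _); apply: le_trans xs.
    rewrite /dotv (bigD1 i)//= !mxE -expr2 lerDl sumr_ge0// => j _.
    by rewrite -expr2 sqr_ge0.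
  have := normr_ge0 s2; move: `|s2| => s s0 h; apply/andP; split; nra.
Qed.

(** The conditions at an interior maximum are read off along each line through it. A negative s1
    turns the annulus into a closed ball. *)
Lemma annulus_max F G H (y z : 'rV[R]_n) (s1 s2 : R) : twice_derivable F G H ->
  s1 <= dotv (z - y) (z - y) <= s2 ->
  exists x, [/\ s1 <= dotv (x - y) (x - y) <= s2,
    forall x', s1 <= dotv (x' - y) (x' - y) <= s2 -> F x' <= F x &
    s1 < dotv (x - y) (x - y) < s2 ->
      G x = 0 /\ forall v, quad_form (H x) v <= 0].
Proof.
move=> [cF dF ddF] hz.
have [|||x] := @EVT_max_rV R n F [set x : 'rV[R]_n | s1 <= dotv (x - y) (x - y) <= s2].
- by exists z.
- exact: compact_annulus.
- exact: continuous_subspaceT.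
rewrite inE /= => hx mx; exists x; split=> //.
  by move=> x' hx'; apply: mx; rewrite inE.
move=> hx'.
have key v : dotv (G x) v = 0 /\ quad_form (H x) v <= 0.
  have lc : {for (0 : R), continuous (fun s : R => x + s *: v)}.
    apply: cvgD; [exact: cvg_cst|apply: cvgZr_tmp; exact: cvg_id].
  have : \forall s \near (0 : R), s1 < dotv (x + s *: v - y) (x + s *: v - y) < s2.
    have cq : {for (0 : R), continuous (fun s : R => dotv (x + s *: v - y) (x + s *: v - y))}.
      exact: (continuous_comp lc (@continuous_sqdist y _)).
    have [q1 q2] := andP hx'.
    have c1 := cvgr_gt _ cq; have c2 := cvgr_lt _ cq.
    near=> s; apply/andP; split; near: s; [apply: c1|apply: c2]; by rewrite scale0r addr0.
  move=> /nbhs_ballP[e /= e0 he].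
  have [||||h1 h2] := @second_derivative_at_max R (fun s => F (x + s *: v))
      (fun s => dotv (G (x + s *: v)) v) (quad_form (H x) v) e.
  - exact: e0.
  - by move=> t; exact: is_derive_line.
  - by apply: (is_derive_line (F := fun z => dotv (G z) v)); rewrite scale0r addr0.
  - move=> t te; rewrite scale0r addr0; apply: mx; rewrite inE /=.
    have /andP[a b] : s1 < dotv (x + t *: v - y) (x + t *: v - y) < s2.
      by apply: he; rewrite -ball_normE /ball_ /= sub0r normrN.
    by rewrite !ltW.
  by move: h1; rewrite scale0r addr0.
split=> [|v]; last by have [] := key v.
by apply: dotv_eq0; have [] := key (G x).
Unshelve. all: by end_near. Qed.

End annulus.

(** * The barrier and the strong maximum principle *)

Lemma mxtrace_mul_rank1 {R : realType} {n} (P : 'M[R]_n) z :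
  \tr (P *m (z^T *m z)) = quad_form P z.
Proof. by rewrite mulmxA mxtrace_mulC mulmxA [_ *m z^T]mx11_scalar mxtrace_scalar. Qed.

Lemma mxtrace_mul_le0 {R : realType} {n} (P S : 'M[R]_n) : sym_posdef P ->
  (forall x, quad_form S x <= 0) -> \tr (P *m S) <= 0.
Proof.
move=> pP hS; have := mxtrace_mul_ge0 pP (S := - S).
rewrite mulmxN linearN /= oppr_ge0; apply=> x.
by rewrite quad_formNl oppr_ge0.
Qed.

Lemma mxtrace_inv_mul_ge {R : realType} {n} (P Q : 'M[R]_n) (mu : R) : sym_posdef P ->
  (forall z, mu * dotv z z <= quad_form Q z) ->
  mu * \tr (invmx P) <= \tr (invmx P *m Q).
Proof.
move=> pP hQ; have : 0 <= \tr (invmx P *m (Q - mu *: 1%:M)).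
  apply: mxtrace_mul_ge0 (sym_posdef_invmx pP) _ => z.
  by rewrite quad_formDl quad_formNl quad_formZl quad_form1 subr_ge0.
by rewrite mulmxBr linearB /= -scalemxAr mulmx1 mxtraceZ subr_ge0.
Qed.

(* The excess of concavity controls the trace of P^-1, which is what replaces
   an a priori bound on the Hessian. *)
Lemma concavity_excess_ge {R : realType} {n} (P Q : 'M[R]_n) :
  sym_posdef P -> sym_posdef Q ->
  2^-1 * \tr (invmx P *m Q) - n%:R * ln 2 <=
  \tr (invmx P *m Q) - n%:R - (ln (\det Q) - ln (\det P)).
Proof.
move=> pP pQ.
(* Pairing P^-1 with Q / 2 instead of Q costs n ln 2 in the determinant but saves half of the
   trace. *)
have h2 : (0 : R) < 2^-1 by rewrite invr_gt0.
have := ln_det_mul_le (sym_posdef_invmx pP) (sym_posdefZ h2 pQ).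
rewrite det_inv detZ lnM ?posrE ?exprn_gt0 ?sym_posdef_det_gt0//.
rewrite lnXn// !lnV ?posrE ?sym_posdef_det_gt0//.
rewrite -scalemxAr mxtraceZ mulNrn -mulr_natl; lra.
Qed.

(** Here P = A + D^2 g, Q = A + D^2 psi, p = x - y, w = D (g - psi), and L, M are the gradient and
    Hessian of the exponent - al |x - y|^2 - (8 / mu) al (g - psi). Positivity says that its
    exponential is a strict subsolution of the operator linearised at g. If tr P^-1 is at least [T],
    the concavity excess wins; otherwise P^-1 is bounded below and the quadratic term in L wins for
    large al. The condition on K and r keeps w from cancelling p in L. *)
Lemma barrier_exponent {R : realType} {n} (a : 'rV[R]_n) (mu K D r s : R) :
  0 < mu -> 0 < r -> (8 / mu) ^+ 2 * K <= r ->
  exists2 al, 0 < al & forall (P Q : 'M[R]_n) (p w : 'rV[R]_n),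
    sym_posdef P -> sym_posdef Q -> (forall z, mu * dotv z z <= quad_form Q z) ->
    ln (\det P) <= D -> ln (\det P) - ln (\det Q) = - dotv a w ->
    dotv w w <= K -> r <= dotv p p <= s ->
    forall L M, L = (- al) *: (2 *: p) + (- (8 / mu * al)) *: w ->
    M = (- al) *: (2 *: 1%:M) + (- (8 / mu * al)) *: (P - Q) ->
    0 < dotv a L + \tr (invmx P *m M) + quad_form (invmx P) L.
Proof.
move=> mu0 r0 Kr; pose k := 8 / mu; have k0 : 0 < k by rewrite divr_gt0.
pose E := dotv a a + `|s|.
have E0 : 0 <= E by rewrite addr_ge0 ?dotv_ge0.
(* For t >= T the excess contributes at least 4 t - k n ln 2, which beats 2 t + E. *)
pose T := E + k * (n%:R * ln 2) + 1.
have ln2 : 0 <= ln (2 : R) by rewrite ln_ge0// ler1n.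
have kn : 0 <= k * (n%:R * ln 2) by apply: mulr_ge0; [exact: ltW|apply: mulr_ge0].
have [m m0 hm] := sym_posdef_lower_bound n T D.
(* Below T the quadratic term is at least m |L|^2 >= al^2 m r = al (E + 2 T + 1), while the negative
   terms are at most al (E + 2 T). *)
pose al := (E + 2 * T + 1) / (m * r).
have al0 : 0 < al by rewrite divr_gt0 ?mulr_gt0// /T; lra.
exists al => //.
have eal : al * m * r = E + 2 * T + 1 by rewrite /al; field; rewrite !gt_eqF.
move=> P Q p w pP pQ hQ PD aw wK /andP[rp ps] L M eL eM.
have pV := sym_posdef_invmx pP.
set t := \tr (invmx P); set ta := \tr (invmx P *m Q).
have t_ta : mu * t <= ta := mxtrace_inv_mul_ge pP hQ.
have t0 : 0 <= t.
  have := mxtrace_mul_ge0 pV (S := 1%:M); rewrite mulmx1; apply=> z.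
  by rewrite quad_form1 dotv_ge0.
have trM : \tr (invmx P *m M) = - 2 * al * t - k * al * (n%:R - ta).
  rewrite eM mulmxDr -!scalemxAr mulmx1 mulmxBr mulVmx ?sym_posdef_unitmx//.
  rewrite mxtraceD !mxtraceZ linearB /= mxtrace1 -/t -/ta -/k; ring.
have aL : dotv a L = - 2 * al * dotv a p + k * al * (ln (\det P) - ln (\det Q)).
  by rewrite eL dotvDr !dotvZr aw -/k; ring.
have ap : 2 * dotv a p <= E.
  have := @dotv_young _ _ 1 a p ltr01; rewrite invr1 !mul1r => h.
  have := ler_norm (dotv a p); have := le_trans ps (ler_norm s); rewrite /E; lra.
have ex0 : 0 <= ta - n%:R - (ln (\det Q) - ln (\det P)).
  have := ln_det_mul_le pV pQ.
  by rewrite det_inv lnV ?posrE ?sym_posdef_det_gt0// -/ta; lra.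
have ex1 := concavity_excess_ge pP pQ; rewrite -/ta in ex1.
set X := ta - _ - _ in ex0 ex1.
have -> : dotv a L + \tr (invmx P *m M) = al * (- (2 * dotv a p) - 2 * t + k * X).
  by rewrite aL trM /X; ring.
have [Tt|tT] := leP T t.
  apply: ltr_wpDr; first exact: sym_posdef_ge0.
  apply: mulr_gt0 => //.
  have : k * (2^-1 * (mu * t) - n%:R * ln 2) <= k * X.
    apply: ler_wpM2l; first exact: ltW.
    by apply: le_trans ex1; rewrite lerD2r ler_wpM2l// invr_ge0.
  have -> : k * (2^-1 * (mu * t) - n%:R * ln 2) = 4 * t - k * (n%:R * ln 2).
    by rewrite /k; field; rewrite gt_eqF.
  by move: Tt; rewrite /T; lra.
have qL : m * dotv L L <= quad_form (invmx P) L.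
  apply: hm => //; first exact: ltW.
  by rewrite det_inv lnV ?posrE ?sym_posdef_det_gt0// lerN2.
(* Since 2 al p = - (L + k al w), the parallelogram bound gives |L|^2 >= 2 al^2 |p|^2 - al^2 k^2
   |w|^2, and k^2 |w|^2 <= r <= |p|^2. *)
have LL : al ^+ 2 * r <= dotv L L.
  have := dotv_parallelogram L (- ((- (k * al)) *: w)).
  rewrite {1 2}eL addrK !dotvNl !dotvNr !opprK !dotvZl !dotvZr => h.
  have h1 : al ^+ 2 * (k ^+ 2 * dotv w w) <= al ^+ 2 * r.
    rewrite ler_wpM2l ?sqr_ge0//; apply: le_trans Kr.
    by rewrite ler_wpM2l// sqr_ge0.
  have h2 : al ^+ 2 * r <= al ^+ 2 * dotv p p by rewrite ler_wpM2l// sqr_ge0.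
  move: h h1 h2; rewrite -/k; set W := dotv w w; set pp := dotv p p; set LLv := dotv L L.
  by move=> h h1 h2; nra.
have kX : 0 <= k * X by rewrite mulr_ge0// ltW.
have : al * (E + 2 * T + 1) <= quad_form (invmx P) L.
  apply: le_trans qL; rewrite -eal.
  have := ler_wpM2l (ltW m0) LL; rewrite expr2; lra.
have : 0 < al * (- (2 * dotv a p) - 2 * t + k * X + (E + 2 * T + 1)).
  apply: mulr_gt0 => //; lra.
by lra.
Qed.

(** The equation in logarithmic form. Explicit derivative fields let lattice translates count as
    solutions at once, and neither F nor V is required to be periodic. *)
Definition ma_solution {R : realType} {n} (A : 'M[R]_n) (a : 'rV[R]_n)
    (V : 'rV[R]_n -> R) (c : R) F G H : Prop :=
  [/\ twice_derivable F G H, forall x, sym_posdef (A + H x) &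
      forall x, ln (\det (A + H x)) = - dotv a (G x) + V x - c].

(* A strong maximum principle for h - g, uniform in g and h: the barrier is
   exp (- al |x - y|^2 - Lam (g - psi)), where the term g - psi makes up for
   the missing upper bound on the Hessian of g.  The price is that the ball
   where h - g is away from its supremum has to be large compared with the
   gradient of g - psi. *)
Lemma propagation {R : realType} {n} (A : 'M[R]_n) a V c psi Gpsi Hpsi
    (mu K B D r s delta : R) :
  ma_solution A a V c psi Gpsi Hpsi -> 0 < mu ->
  (forall x z, mu * dotv z z <= quad_form (A + Hpsi x) z) ->
  0 < r -> (8 / mu) ^+ 2 * K <= r -> 0 <= B -> 0 <= s -> 0 < delta ->
  exists2 eps, 0 < eps & forall g Gg Hg h Gh Hh y S,
    ma_solution A a V c g Gg Hg -> ma_solution A a V c h Gh Hh ->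
    (forall x, dotv (Gg x - Gpsi x) (Gg x - Gpsi x) <= K) ->
    (forall x, `|g x - psi x| <= B) ->
    (forall x, ln (\det (A + Hg x)) <= D) ->
    (forall x, h x - g x <= S) ->
    (forall x, dotv (x - y) (x - y) <= r -> h x - g x <= S - delta) ->
    forall x, dotv (x - y) (x - y) <= s -> h x - g x <= S - eps.
Proof.
move=> [psi2 psiP psiE] mu0 hmu r0 Kr B0 s0 del0.
pose k := 8 / mu; have k0 : 0 < k by rewrite divr_gt0.
have kB : 0 <= k * B by rewrite mulr_ge0// ltW.
(* The outer radius is such that the exponent is at most [k1] on the outer sphere, strictly below
   its values where |x - y|^2 <= s, although g - psi can shift it by k al B either way. *)
pose s' := s + 2 * (k * B) + r + 1.
have [al al0 hal] := barrier_exponent a D s' mu0 r0 Kr.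
rewrite -/k in hal.
pose k1 := - al * s' + k * al * B.
pose b0 := expR (- al * s - k * al * B) - expR k1.
have b00 : 0 < b0.
  rewrite subr_gt0 ltr_expR /k1 /s'.
  have : 0 < al * (r + 1) by rewrite mulr_gt0//; lra.
  by lra.
(* The exponent is at most k al B everywhere, so the added term never exceeds delta. *)
pose th := delta / expR (k * al * B).
have th0 : 0 < th by rewrite divr_gt0// expR_gt0.
exists (Num.min delta (th * b0)); first by rewrite lt_min del0 mulr_gt0.
move=> g Gg Hg h Gh Hh y S [g2 gP gE] [h2 hP hE] gK gB gD hS hr x xs.
have kalB z : `|k * al * (g z - psi z)| <= k * al * B.
  by rewrite normrM (gtr0_norm (mulr_gt0 k0 al0)) ler_wpM2l// ltW// mulr_gt0.
have [xr|rx] := leP (dotv (x - y) (x - y)) r.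
  by apply: le_trans (hr _ xr) _; rewrite lerD2l lerN2 ge_min lexx.
pose Psi z := - al * dotv (z - y) (z - y) + (- (k * al)) * (g z - psi z).
have Psi2 := twice_derivableD (twice_derivableZ (- al) (twice_derivable_sqdist y))
  (twice_derivableZ (- (k * al)) (twice_derivableB g2 psi2)).
have Z2 := twice_derivableD (twice_derivableB h2 g2)
  (twice_derivableZ th (twice_derivable_expR Psi2)).
have [|z [/andP[zr zs] zmax zloc]] := annulus_max (y := y) (z := x) (s1 := r) (s2 := s') Z2.
  by rewrite ltW//= /s'; lra.
(* The maximum point z of the perturbed difference lies on the inner sphere, where the gap delta
   pays for the barrier, on the outer sphere, where the barrier is small, or inside, which is
   refuted. *)
have : h x - g x + th * expR (Psi x) <= S + th * expR k1.
  apply: (@le_trans _ _ (h z - g z + th * expR (Psi z))).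
    by apply: zmax; rewrite ltW//= /s'; lra.
  have := kalB z; rewrite ler_norml => /andP[kz1 kz2].
  have [zr'|rz] := leP (dotv (z - y) (z - y)) r.
    have := hr _ zr'.
    have : th * expR (Psi z) <= delta.
      rewrite /th mulrAC ler_pdivrMr ?expR_gt0// ler_pM2l// ler_expR /Psi.
      have : 0 <= al * dotv (z - y) (z - y) by rewrite mulr_ge0 ?dotv_ge0// ltW.
      by lra.
    have : 0 < th * expR k1 by rewrite mulr_gt0// expR_gt0.
    by lra.
  have [sz|zs'] := leP s' (dotv (z - y) (z - y)).
    apply: lerD (hS z) _; rewrite ler_pM2l// ler_expR /Psi /k1.
    have : al * s' <= al * dotv (z - y) (z - y) by rewrite ler_wpM2l// ltW.
    by lra.
  have [|GZ HZ] := zloc; first by rewrite rz.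
  exfalso; pose E := th * expR (Psi z); have E0 : 0 < E by rewrite mulr_gt0// expR_gt0.
  pose L := (- al) *: (2 *: (z - y)) + (- (k * al)) *: (Gg z - Gpsi z).
  pose M := (- al) *: (2 *: 1%:M) + (- (k * al)) *: ((A + Hg z) - (A + Hpsi z)).
  have := hal (A + Hg z) (A + Hpsi z) (z - y) (Gg z - Gpsi z) (gP z) (psiP z) (hmu z) (gD z).
  rewrite gE psiE => /(_ _ (gK z)); rewrite zr zs => /(_ _ isT L M erefl erefl) pos.
  have {pos} : 0 < dotv a L + \tr (invmx (A + Hg z) *m M) + quad_form (invmx (A + Hg z)) L.
    by apply: pos; rewrite dotvDr dotvNr; ring.
  have GZ' : Gh z - Gg z = - (E *: L).
    by apply/eqP; rewrite -addr_eq0 /E -scalerA; apply/eqP.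
  have eM : M = (- al) *: (2 *: 1%:M) + (- (k * al)) *: (Hg z - Hpsi z).
    by rewrite /M opprD addrACA subrr add0r.
  have tr0 : \tr (invmx (A + Hg z) *m (Hh z - Hg z + E *: (M + L^T *m L))) <= 0.
    apply: mxtrace_mul_le0 (sym_posdef_invmx (gP z)) _ => v.
    by rewrite eM /E -scalerA; exact: HZ.
  rewrite mulmxDr mxtraceD -scalemxAr mxtraceZ [X in E * \tr X]mulmxDr mxtraceD in tr0.
  rewrite mxtrace_mul_rank1 in tr0.
  (* Concavity bounds E a.L by tr (P^-1 (D^2 h - D^2 g)), with P = A + D^2 g, and the maximum bounds
     that trace by - E (tr (P^-1 M) + L P^-1 L^T), against the positivity of the barrier
     expression. *)
  have := ln_det_concave (gP z) (hP z).
  have -> : A + Hh z - (A + Hg z) = Hh z - Hg z by rewrite opprD addrACA subrr add0r.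
  have -> : ln (\det (A + Hh z)) - ln (\det (A + Hg z)) = E * dotv a L.
    by rewrite gE hE -dotvZr -[E *: L]opprK -GZ' dotvNr dotvDr dotvNr; ring.
  by move=> h1 /(mulr_gt0 E0); rewrite !mulrDr in tr0 *; lra.
have : th * b0 <= th * (expR (Psi x) - expR k1).
  rewrite ler_pM2l// lerD2r ler_expR /Psi.
  have : al * dotv (x - y) (x - y) <= al * s by rewrite ler_wpM2l// ltW.
  by have := kalB x; rewrite ler_norml => /andP[kz1 kz2]; lra.
have : Num.min delta (th * b0) <= th * b0 by rewrite ge_min lexx orbT.
by lra.
Qed.

(** The mean value theorem on the segment, with Young's inequality in place of Cauchy-Schwarz; sg is
    tuned at each use. *)
Lemma twice_derivable_lipschitz {R : realType} {n} (F : 'rV[R]_n -> R) G H (K sg : R) x y :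
  twice_derivable F G H -> (forall z, dotv (G z) (G z) <= K) -> 0 < sg ->
  `|F x - F y| <= (sg * K + sg^-1 * dotv (x - y) (x - y)) / 2.
Proof.
move=> [_ dF _] hK sg0.
have [c _] := @mean_value_0 R (fun s => F (y + s *: (x - y)))
  (fun s => dotv (G (y + s *: (x - y))) (x - y)) 1
  (fun t => is_derive_line (dF (y + t *: (x - y)) (x - y))).
rewrite scale1r scale0r addr0 subrKC mulr1 => ->.
apply: le_trans (dotv_young _ _ sg0) _.
by rewrite ler_pM2r ?invr_gt0// lerD2r ler_pM2l.
Qed.

Lemma ma_solution_shift {R : realType} {n} (A : 'M[R]_n) a V c F G H k :
  (forall x, V (x + k) = V x) -> ma_solution A a V c F G H ->
  ma_solution A a V c (fun x => F (x + k)) (fun x => G (x + k)) (fun x => H (x + k)).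
Proof.
move=> Vk [F2 FP FE]; split=> [|x|x]; first exact: twice_derivable_shift.
  exact: FP.
by rewrite FE Vk.
Qed.

Lemma near_lattice_point {R : realType} {n} (x y : 'rV[R]_n) :
  exists k : 'rV[int]_n, dotv (x + map_mx intr k - y) (x + map_mx intr k - y) <= n%:R.
Proof.
exists (\row_i Num.floor (y 0 i - x 0 i)).
have -> : n%:R = \sum_(i < n) (1 : R) by rewrite sumr_const card_ord.
apply: ler_sum => i _; rewrite !mxE.
have /andP[] := floor_itv (y 0 i - x 0 i).
rewrite intrD; set fl := _%:~R; move=> h1 h2; nra.
Qed.

(** * The Liouville theorem for bounded solutions *)

Section liouville.
Context {R : realType} {n : nat} (A : 'M[R]_n) (a : 'rV[R]_n) (V : 'rV[R]_n -> R) (c : R).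
Context (psi f : 'rV[R]_n -> R) (Gpsi Gf : 'rV[R]_n -> 'rV[R]_n)
  (Hpsi Hf : 'rV[R]_n -> 'M[R]_n) (mu K B D : R).
Context (psi_sol : ma_solution A a V c psi Gpsi Hpsi).
Context (f_sol : ma_solution A a V c f Gf Hf).
Context (mu0 : 0 < mu).
Context (psi_mu : forall x z, mu * dotv z z <= quad_form (A + Hpsi x) z).
Context (fK : forall x, dotv (Gf x - Gpsi x) (Gf x - Gpsi x) <= K).
Context (fB : forall x, `|f x - psi x| <= B).
Context (fD : forall x, ln (\det (A + Hf x)) <= D).
Context (psiD : forall x, ln (\det (A + Hpsi x)) <= D).
Context (V_periodic : Zn_periodic V).
Context (psi_periodic : Zn_periodic psi).

Let w x := f x - psi x.

Let w_lipschitz x y (sg : R) : 0 < sg ->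
  `|w x - w y| <= (sg * K + sg^-1 * dotv (x - y) (x - y)) / 2.
Proof.
have [psi2 _ _] := psi_sol; have [f2 _ _] := f_sol.
exact: twice_derivable_lipschitz (twice_derivableB f2 psi2) fK.
Qed.

Let B0 : 0 <= B. Proof. exact: le_trans (normr_ge0 _) (fB 0). Qed.

Let K0 : 0 <= K. Proof. exact: le_trans (dotv_ge0 _) (fK 0). Qed.

(** The case g = psi of [propagation], where K = B = 0 allows any radius. The Lipschitz bound
    spreads half of the gap eps from z to a small ball. The contrapositive is what matters: w near M
    at p forces w near M at z. *)
Lemma below_max_propagates M eps s : (forall x, w x <= M) -> 0 < eps -> 0 <= s ->
  exists2 eps', 0 < eps' & forall z p, dotv (p - z) (p - z) <= s ->
    w z <= M - eps -> w p <= M - eps'.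
Proof.
move=> wM eps0 s0; pose sg := eps / (2 * (K + 1)).
have K1 : 0 < 2 * (K + 1) by have := K0; lra.
have sg0 : 0 < sg by rewrite divr_gt0.
pose r := sg * eps / 2; have r0 : 0 < r by rewrite /r divr_gt0// mulr_gt0.
have sgK : sg * K <= eps / 2.
  rewrite /sg mulrAC ler_pdivrMr//; have := eps0; have := K0; nra.
have [||e' e'0 he'] := @propagation R n A a V c psi Gpsi Hpsi mu 0 0 D r s (eps / 2)
   psi_sol mu0 psi_mu r0 _ (lexx _) s0.
- by rewrite mulr0 ltW.
- by rewrite divr_gt0.
exists e' => // z p pz wz.
apply: (he' psi Gpsi Hpsi f Gf Hf z M) => //.
- by move=> x; rewrite subrr dot0v.
- by move=> x; rewrite subrr normr0.
- move=> x xz; have := w_lipschitz x z sg0; rewrite ler_norml => /andP[_].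
  have : sg^-1 * dotv (x - z) (x - z) <= eps / 2.
    by rewrite ler_pdivrMl// mulrA.
  by rewrite -/(w x); lra.
Qed.

Lemma liouville : exists C, forall x, f x = psi x + C.
Proof.
pose E := range w.
have E0 : E !=set0 by exists (w 0), 0.
have supE : has_sup E.
  by split=> //; exists B => _ [x _ <-]; have := fB x; rewrite ler_norml => /andP[].
have infE : has_inf E.
  by split=> //; exists (- B) => _ [x _ <-]; have := fB x; rewrite ler_norml => /andP[].
pose M := sup E; pose m := inf E.
have wM x : w x <= M by apply: sup_upper_bound => //; exists x.
have wm x : m <= w x by apply: inf_lbound; [case: infE|exists x].
have [Mm|mM] := leP M m.
  exists m => x; apply/eqP; rewrite addrC -subr_eq; apply/eqP/le_anti.
  by rewrite (le_trans (wM x) Mm) wm.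
exfalso; pose eta := (M - m) / 4; have eta0 : 0 < eta by rewrite /eta; lra.
pose r := (8 / mu) ^+ 2 * K + 1.
have Kr0 : 0 <= (8 / mu) ^+ 2 * K by rewrite mulr_ge0 ?sqr_ge0.
have r0 : 0 < r by rewrite /r; lra.
(* R1 serves both for the ball of [propagation] and for the distance n to the lattice translate. *)
pose R1 := r + n%:R; have n0 : 0 <= n%:R :> R by [].
have R10 : 0 <= R1 by rewrite /R1; lra.
have [e0 e00 he0] := below_max_propagates wM eta0 R10.
pose e1 := Num.min e0 eta.
have e10 : 0 < e1 by rewrite lt_min e00.
have e1e0 : e1 <= e0 by rewrite ge_min lexx.
have e1eta : e1 <= eta by rewrite ge_min lexx orbT.
have e14 : 0 < e1 / 4 by rewrite divr_gt0.
have [e2 e20 he2] := below_max_propagates wM e14 R10.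
have [_ [xM _ <-] hxM] := sup_adherent e20 supE.
have [_ [xm _ <-] hxm] := inf_adherent e14 infE.
(* A lattice vector carries the near-minimiser [xm] close to the near-maximiser [xM], so w is near M
   at the image. *)
have [k hk] := near_lattice_point xm xM.
set kk := map_mx intr k in hk.
have wxk : M - e1 / 4 < w (xm + kk).
  rewrite ltNge; apply/negP => /(he2 _ xM) h; have : w xM <= M - e2.
    apply: h; rewrite -opprB dotvNl dotvNr opprK; apply: le_trans hk _.
    by rewrite /R1; lra.
  by move: hxM; rewrite -/M; lra.
pose d x := f (x + kk) - f x.
have dw x : d x = w (x + kk) - w x by rewrite /w psi_periodic /d; ring.
have supd : has_sup (range d).
  split; first by exists (d 0), 0.
  exists (M - m) => _ [x _ <-]; rewrite dw; have := wM (x + kk); have := wm x; lra.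
pose S := sup (range d).
have dS x : d x <= S by apply: sup_upper_bound => //; exists x.
have S1 : M - m - e1 / 2 < S.
  have := dS xm; rewrite dw; move: hxm; rewrite -/m; lra.
have [dl dl0 hdl] := @propagation R n A a V c psi Gpsi Hpsi mu K B D r (dotv kk kk) (e1 / 4)
   psi_sol mu0 psi_mu r0 (ltW (ltr_pwDr ltr01 (lexx _))) B0 (dotv_ge0 _) e14.
have dl1 : 0 < Num.min dl (e1 / 4) by rewrite lt_min dl0.
have [_ [x0 _ <-] hx0] := sup_adherent dl1 supd.
have dx0 : S - dl < d x0 /\ S - e1 / 4 < d x0.
  have : Num.min dl (e1 / 4) <= dl by rewrite ge_min lexx.
  have : Num.min dl (e1 / 4) <= e1 / 4 by rewrite ge_min lexx orbT.
  by move: hx0; rewrite -/S; lra.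
(* Otherwise d stays e1 / 4 below S on the whole ball around x0 + kk, and [propagation] lowers d at
   x0, where it almost attains S. *)
have [z [zy zd]] : exists z, dotv (z - (x0 + kk)) (z - (x0 + kk)) <= r /\ S - e1 / 4 < d z.
  apply: contrapT => hz; suff : d x0 <= S - dl by case: dx0; lra.
  apply: (hdl f Gf Hf _ _ _ (x0 + kk) S f_sol
      (ma_solution_shift (V_periodic k) f_sol)) => // [z zr|].
    by rewrite leNgt; apply/negP => zS; apply: hz; exists z.
  by rewrite opprD addrA subrr add0r dotvNl dotvNr opprK.
(* As w <= M at z + kk and d z nearly reaches M - m, w is close to m at z; likewise w >= m at x0
   makes w close to M at x0 + kk. *)
have wz : w z <= M - eta.
  have := wM (z + kk); have := dw z; rewrite /eta in e1eta *; lra.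
have : w (x0 + kk) <= M - e0.
  apply: (he0 z) => //; rewrite -opprB dotvNl dotvNr opprK /R1; lra.
have := dw x0; have := wm x0; case: dx0 => _; lra.
Qed.

End liouville.

(** * Comparison at penalised maxima: the constant and the drift *)

(** Maximise F1 - F2 - eps |x|^2 on a ball so large that comparison with the value at 0 excludes its
    boundary. *)
Lemma approximate_max {R : realType} {n} (F1 F2 : 'rV[R]_n -> R) G1 G2 H1 H2 (B eps : R) :
  twice_derivable F1 G1 H1 -> twice_derivable F2 G2 H2 ->
  (forall x, `|F1 x - F2 x| <= B) -> 0 < eps ->
  exists x, [/\ G1 x - G2 x = (2 * eps) *: x, eps * dotv x x <= 2 * B + 1 &
    forall v, quad_form (H1 x - H2 x) v <= 2 * eps * dotv v v].
Proof.
move=> F1d F2d FB eps0.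
have := twice_derivableB (twice_derivableB F1d F2d)
  (twice_derivableZ eps (twice_derivable_sqdist 0)).
set s := (2 * B + 1) / eps; have se : eps * s = 2 * B + 1.
  by rewrite /s mulrCA divff ?gt_eqF// mulr1.
have B0 : 0 <= B by apply: le_trans (FB 0).
have s0 : 0 < s by rewrite divr_gt0//; lra.
move=> /(@annulus_max _ _ _ _ _ 0 0 (-1) s)[|x [xs xmax xloc]].
  by rewrite subrr dot0v lerN10 ltW.
have x_lt : dotv (x - 0) (x - 0) < s.
  rewrite ltNge; apply/negP => sx.
  have := xmax 0; rewrite !subrr dot0v lerN10 ltW// mulr0 subr0 => /(_ isT).
  have := ler_wpM2l (ltW eps0) sx; rewrite se.
  have := FB 0; have := FB x; rewrite !ler_norml => /andP[_ h1] /andP[h2 _]; lra.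
have [|/eqP Gx Hx] := xloc.
  by rewrite x_lt andbT (lt_le_trans (ltrN10 R))// dotv_ge0.
rewrite subr0 in x_lt Gx; exists x; split=> [||v].
- by move: Gx; rewrite subr_eq0 scalerA mulrC => /eqP.
- by rewrite -se ler_pM2l// ltW.
- have := Hx v; rewrite quad_formDl quad_formNl scalerA quad_formZl quad_form1 subr_le0.
  by rewrite [eps * 2]mulrC.
Qed.

Lemma le_of_small_multiples {R : realType} (x y C r : R) : 0 < r ->
  (forall t, 0 < t -> t <= r -> x <= y + t * C) -> x <= y.
Proof.
move=> r0 h; rewrite leNgt; apply/negP => yx.
have C1 : 0 < `|C| + 1 by rewrite ltr_wpDl.
pose t := Num.min r ((x - y) / 2 / (`|C| + 1)).
have t0 : 0 < t by rewrite lt_min r0 !divr_gt0// subr_gt0.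
have tr : t <= r by rewrite ge_min lexx.
have : t * (`|C| + 1) <= (x - y) / 2 by rewrite -ler_pdivlMr// ge_min lexx orbT.
have := h _ t0 tr; have : t * C <= t * `|C| by rewrite ler_pM2l// ler_norm.
by lra.
Qed.

(** With penalty eps = t^2 the maximum point has size O(1 / t), so the gradient difference 2 t^2 x
    is of order t. *)
Lemma drift_small {R : realType} {n} (a x : 'rV[R]_n) (B t : R) : 0 < t ->
  t ^+ 2 * dotv x x <= 2 * B + 1 ->
  `|dotv a ((2 * t ^+ 2) *: x)| <= t * (dotv a a + (2 * B + 1)).
Proof.
move=> t0 h; have ti : 0 < t^-1 by rewrite invr_gt0.
rewrite dotvZr normrM gtr0_norm ?mulr_gt0// ?exprn_gt0//.
have h1 := dotv_young a x ti; rewrite invrK in h1.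
apply: (@le_trans _ _ (t ^+ 2 * (t^-1 * dotv a a + t * dotv x x))).
  by rewrite -mulrA mulrCA ler_pM2l ?exprn_gt0//; lra.
have -> : t ^+ 2 * (t^-1 * dotv a a + t * dotv x x) = t * (dotv a a + t ^+ 2 * dotv x x).
  by field; rewrite gt_eqF.
by rewrite ler_pM2l// lerD2l.
Qed.

Lemma ln_det_scale {R : realType} {n} (P : 'M[R]_n) s : 0 < s -> sym_posdef P ->
  ln (\det (s *: P)) = n%:R * ln s + ln (\det P).
Proof.
move=> s0 pP; rewrite detZ lnM ?posrE ?exprn_gt0 ?sym_posdef_det_gt0// lnXn//.
by rewrite mulr_natl.
Qed.

Lemma ma_constant_unique {R : realType} {n} (A : 'M[R]_n) a V c1 c2
    (f psi : 'rV[R]_n -> R) Gf Gpsi Hf Hpsi (mu B : R) :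
  ma_solution A a V c1 f Gf Hf -> ma_solution A a V c2 psi Gpsi Hpsi ->
  0 < mu -> (forall x z, mu * dotv z z <= quad_form (A + Hpsi x) z) ->
  (forall x, `|f x - psi x| <= B) -> c1 = c2.
Proof.
move=> [f2 fP fE] [psi2 psiP psiE] mu0 hmu fB.
have B0 : 0 <= B by apply: le_trans (fB 0).
have AD x : A + Hf x - (A + Hpsi x) = Hf x - Hpsi x by rewrite opprD addrACA subrr add0r.
(* The error 2 t^2 |z|^2 in the Hessian comparison becomes a factor 1 + s or 1 - s on A + D^2 psi,
   with s = 2 t^2 / mu. *)
have mu2 (t : R) x z : 2 * t ^+ 2 * dotv z z <=
    2 * t ^+ 2 / mu * quad_form (A + Hpsi x) z.
  rewrite -[leRHS]mulrA; apply: ler_wpM2l; first by rewrite mulr_ge0 ?sqr_ge0.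
  by rewrite ler_pdivlMl.
have n0 : 0 <= n%:R :> R by [].
apply: le_anti; apply/andP; split; last first.
  apply: (@le_of_small_multiples _ _ _ (n%:R * (2 / mu) + (dotv a a + (2 * B + 1))) 1) => //.
  move=> t t0 t1; have [x [Gx xB Hx]] := approximate_max f2 psi2 fB (exprn_gt0 2 t0).
  have := drift_small a t0 xB; rewrite -Gx dotvDr dotvNr ler_norml => /andP[_ ax].
  pose s := 2 * t ^+ 2 / mu; have s0 : 0 < s by rewrite divr_gt0// mulr_gt0// exprn_gt0.
  have s1 : 0 < 1 + s by lra.
  have := ln_det_mono (sym_posdefZ s1 (psiP x)) (fP x).
  rewrite ln_det_scale// => /(_ _) hm.
  have {}hm : ln (\det (A + Hf x)) <= n%:R * ln (1 + s) + ln (\det (A + Hpsi x)).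
    apply: hm => v; rewrite -[A + Hf x](subrK (A + Hpsi x)) AD quad_formDl quad_formZl.
    have := Hx v; have := mu2 t x v; rewrite -/s; lra.
  have : n%:R * ln (1 + s) <= n%:R * (t * (2 / mu)).
    apply: ler_wpM2l => //; apply: le_trans (le_ln1Dx _) _; first lra.
    rewrite /s expr2; have : 0 < 2 / mu by rewrite divr_gt0.
    set m := 2 / mu; have -> : 2 * (t * t) / mu = t * t * m by rewrite /m; ring.
    by move=> m0; rewrite -mulrA ler_pM2l// ler_piMl// ltW.
  by move: hm; rewrite fE psiE; lra.
(* Restricting t to at most mu / 4 gives s <= 1 / 2, so that - ln (1 - s) <= 2 s. *)
apply: (@le_of_small_multiples _ _ _ (n%:R * (4 / mu) + (dotv a a + (2 * B + 1))) (Num.min 1 (mu / 4))) => //.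
  by rewrite lt_min ltr01 divr_gt0.
move=> t t0; rewrite le_min => /andP[t1 tmu].
have fB' x : `|psi x - f x| <= B by rewrite distrC.
have [x [Gx xB Hx]] := approximate_max psi2 f2 fB' (exprn_gt0 2 t0).
have := drift_small a t0 xB; rewrite -Gx dotvDr dotvNr ler_norml => /andP[_ ax].
pose s := 2 * t ^+ 2 / mu; have s0 : 0 < s by rewrite divr_gt0// mulr_gt0// exprn_gt0.
have st : s <= t * (2 / mu).
  rewrite /s expr2; set m := 2 / mu.
  have -> : 2 * (t * t) / mu = t * t * m by rewrite /m; ring.
  by rewrite -mulrA ler_pM2l// ler_piMl// divr_ge0// ltW.
have s12 : s <= 2^-1.
  apply: le_trans st _; rewrite mulrA ler_pdivrMr//; lra.
have s1 : 0 < 1 - s by lra.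
have := ln_det_mono (fP x) (sym_posdefZ s1 (psiP x)).
rewrite ln_det_scale// => /(_ _) hm.
have {}hm : n%:R * ln (1 - s) + ln (\det (A + Hpsi x)) <= ln (\det (A + Hf x)).
  apply: hm => v; rewrite quad_formZl.
  have -> : quad_form (A + Hf x) v = quad_form (A + Hpsi x) v - quad_form (Hpsi x - Hf x) v.
    by rewrite -quad_formNl -quad_formDl opprB -AD subrKC.
  have := Hx v.
  have := mu2 t x v; rewrite -/s; lra.
have : - ln (1 - s) <= 2 * s.
  rewrite -lnV ?posrE//; apply: le_trans (ln_le_subr1 _) _; first by rewrite invr_gt0.
  by rewrite lerBlDr -[X in X <= _]mul1r ler_pdivrMr//; nra.
move=> /(ler_wpM2l n0) h1.
have := ler_wpM2l n0 st; move: hm; rewrite fE psiE; lra.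
Qed.

Lemma drift_vanishes {R : realType} {n} (A : 'M[R]_n) (a be : 'rV[R]_n) V c
    (f : 'rV[R]_n -> R) G H (CV : R) :
  sym_posdef A -> twice_derivable f G H -> (forall x, sym_posdef (A + H x)) ->
  (forall x, ln (\det (A + H x)) = - dotv a (G x) + dotv be x + V x - c) ->
  (forall x, `|V x| <= CV) ->
  (forall e, 0 < e -> exists r0, forall r x, r0 <= r -> dotv x x < r ^+ 2 ->
     `|f x| <= e * r ^+ 2) ->
  be = 0.
Proof.
move=> pA f2 fP fE VC grow; apply/eqP; apply: contraT => be0.
have := dotv_gt0 be0; set b2 := dotv be be => b20.
pose N := dotv (be - 2 *: a) (be - 2 *: a) + 1.
have N0 : 0 < N by rewrite ltr_wpDl// dotv_ge0.
(* sg and d2 make both halves of Young's bound for (be - 2 a).p at most rho b2 / 2, so only half of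
   the drift gain rho b2 is lost. *)
pose sg := b2 / (2 * N); have sg0 : 0 < sg by rewrite divr_gt0// mulr_gt0.
pose d2 := sg * b2 / 2; have d20 : 0 < d2 by rewrite divr_gt0// mulr_gt0.
(* The ball of squared radius d2 rho^2 around rho be lies inside the ball of squared radius k2 rho^2
   around 0. *)
pose k2 := 2 * b2 + 2 * d2 + 1; have k20 : 0 < k2 by rewrite /k2; lra.
(* With this tolerance |f| <= d2 rho^2 / 4 on the ball, too little to offset the penalty d2 rho^2 on
   its boundary: the maximum is interior. *)
have [r0 hr0] := grow (d2 / (4 * k2)) (divr_gt0 d20 (mulr_gt0 (ltr0Sn R 3) k20)).
pose k := Num.sqrt k2; have k0 : 0 < k by rewrite sqrtr_gt0.
have kk : k ^+ 2 = k2 by rewrite sqr_sqrtr// ltW.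
(* The inequality at the maximum reads rho b2 / 2 <= C, which a large rho violates. *)
pose C := ln (\det A) + 2 * \tr (invmx A) + CV + c.
pose rho := `|r0| / k + 2 * `|C| / b2 + 1.
have rho0 : 0 < rho.
  by rewrite ltr_wpDl// addr_ge0// divr_ge0// ?mulr_ge0// ltW.
have rho1 : r0 <= k * rho.
  apply: le_trans (ler_norm _) _; rewrite mulrC -ler_pdivrMr// /rho.
  have : 0 <= 2 * `|C| / b2 by rewrite divr_ge0// ?mulr_ge0// ltW.
  by lra.
have rho2 : C < rho * b2 / 2.
  apply: le_lt_trans (ler_norm _) _; rewrite ltr_pdivlMr// mulrC -ltr_pdivrMr// /rho.
  have : 0 <= `|r0| / k by rewrite divr_ge0// ltW.
  by lra.
have fsmall x : dotv (x - rho *: be) (x - rho *: be) <= d2 * rho ^+ 2 ->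
    `|f x| <= d2 * rho ^+ 2 / 4.
  move=> hx; have := hr0 (k * rho) x rho1; rewrite exprMn kk => h.
  have -> : d2 * rho ^+ 2 / 4 = d2 / (4 * k2) * (k2 * rho ^+ 2).
    by field; rewrite gt_eqF.
  apply: h; have := dotv_parallelogram (rho *: be) (x - rho *: be).
  rewrite subrKC [dotv (rho *: be) _]dotvZl dotvZr -/b2 => h.
  have : 0 < rho ^+ 2 by rewrite exprn_gt0.
  move: h hx; rewrite /k2 expr2; set q := dotv (x - _) _; set xx := dotv x x.
  by move=> h1 h2 h3; lra.
have D2 := twice_derivableB f2 (twice_derivable_sqdist (rho *: be)).
have dr : 0 < d2 * rho ^+ 2 by rewrite mulr_gt0// exprn_gt0.
have [|x [/andP[_ xs] xmax xloc]] := annulus_max (y := rho *: be) (z := rho *: be)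
    (s1 := -1) (s2 := d2 * rho ^+ 2) D2.
  by rewrite subrr dot0v lerN10 ltW.
have x_lt : dotv (x - rho *: be) (x - rho *: be) < d2 * rho ^+ 2.
  rewrite ltNge; apply/negP => sx.
  have := xmax (rho *: be); rewrite !subrr dot0v lerN10 ltW// subr0 => /(_ isT).
  have := fsmall _ xs; have := fsmall (rho *: be); rewrite subrr dot0v ltW// => /(_ isT).
  rewrite !ler_norml => /andP[h1 _] /andP[_ h2]; lra.
have [|Gx Hx] := xloc.
  by rewrite x_lt andbT (lt_le_trans (ltrN10 R))// dotv_ge0.
set p := x - rho *: be in xs x_lt Gx Hx.
have := ln_det_concave pA (fP x); rewrite [A + H x - A]addrC addKr.
have : \tr (invmx A *m (H x - 2 *: 1%:M)) <= 0.
  exact: mxtrace_mul_le0 (sym_posdef_invmx pA) Hx.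
rewrite mulmxBr linearB /= -scalemxAr mulmx1 mxtraceZ.
have GE : G x = 2 *: p by apply/eqP; rewrite -subr_eq0; apply/eqP.
have xE : x = p + rho *: be by rewrite subrK.
have bx : dotv be x = dotv be p + rho * b2 by rewrite [in LHS]xE dotvDr dotvZr.
rewrite fE GE bx dotvZr.
have rs0 : 0 < rho * sg by rewrite mulr_gt0.
have := dotv_young (be - 2 *: a) p rs0.
rewrite dotvDl dotvNl dotvZl ler_norml => /andP[h1 _].
have h2 : rho * sg * dotv (be - 2 *: a) (be - 2 *: a) <= rho * b2 / 2.
  apply: (@le_trans _ _ (rho * sg * N)); first by rewrite ler_pM2l// /N; lra.
  by rewrite /sg le_eqVlt; apply/orP; left; apply/eqP; field; rewrite gt_eqF.
have h3 : (rho * sg)^-1 * dotv p p <= rho * b2 / 2.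
  rewrite ler_pdivrMl//; apply: le_trans xs _.
  by rewrite /d2 le_eqVlt; apply/orP; left; apply/eqP; field.
have := VC x; rewrite ler_norml => /andP[h4 _].
by move: rho2; rewrite /C; lra.
Qed.

(** * From essential boundedness to boundedness *)

Section open_box.
Context {R : realType}.

Definition open_box n (x : 'I_n -> R) (d : R) : set (n.-tuple R) :=
  [set t | forall i, tnth t i \in `]x i - d, x i + d[].

Lemma measurable_open_box n (x : 'I_n -> R) d : measurable (open_box x d).
Proof.
have -> : open_box x d =
    \bigcap_(i in [set: 'I_n]) ((@tnth n R)^~ i @^-1` `]x i - d, x i + d[%classic).
  apply/seteqP; split=> t /= h i; first by move=> _ /=; exact: h.
  by have := h i I.
apply: fin_bigcap_measurable => // i _; rewrite -[X in measurable X]setTI.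
by apply: (measurable_tnth i) => //; exact: measurable_itv.
Qed.

Lemma lebesgue_Rn_open_box_gt0 n (x : 'I_n -> R) d : 0 < d ->
  (0 < lebesgue_Rn R n (open_box x d))%E.
Proof.
move=> d0; elim: n x => [|n IH] x.
  rewrite /= diracE; have -> : ([tuple] : 0.-tuple R) \in open_box x d.
    by rewrite inE => -[].
  by rewrite lte01.
(* [consp] puts the new coordinate in front, so the box is a product of the box of the tail and the
   interval at [ord0]. *)
have -> : lebesgue_Rn R n.+1 (open_box x d) =
    ((lebesgue_Rn R n \x @lebesgue_measure R)
      (open_box (fun i => x (lift ord0 i)) d `*` `](x ord0 - d)%R, (x ord0 + d)%R[%classic))%E.
  rewrite /= /prod_lebesgue /pushforward; congr (_ _).
  apply/seteqP; split=> -[t s] /=.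
    move=> h; split; last by have := h ord0; rewrite (tnth_nth 0).
    move=> i; have := h (lift ord0 i).
    by rewrite [tnth (consp _) _](tnth_nth 0) /= -(tnth_nth 0).
  move=> [ht hs] i; have [j ->|->] := unliftP ord0 i.
    by rewrite (tnth_nth 0) /= -(tnth_nth 0); exact: ht.
  by rewrite (tnth_nth 0).
rewrite product_measure1E; [|exact: measurable_open_box|exact: measurable_itv].
apply: mule_gt0; first exact: IH.
rewrite [ltRHS](lebesgue_measure_itv `]x ord0 - d, x ord0 + d[) /= lte_fin ifT; last lra.
by rewrite -EFinB lte_fin; lra.
Qed.

End open_box.

(** By continuity, a point where |f| exceeds the essential bound has a box of positive measure
    around it with the same property. *)
Lemma Linfty_bounded {R : realType} {n} (f : 'rV[R]_n -> R) :
  continuous f -> Linfty f -> exists B, forall x, `|f x| <= B.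
Proof.
move=> cf /sub_Lfun_finLfun; rewrite inE /= /finite_norm unlock.
(* The norm unfolds to an essential supremum only once the whole space is known to have positive
   measure. *)
rewrite ifT; last first.
  apply: lt_le_trans (lebesgue_Rn_open_box_gt0 (fun=> 0) ltr01) _.
  by apply: le_measure; rewrite ?inE//; exact: measurable_open_box.
set e := ess_sup _ _ => e_lt.
have [B eB] : exists B : R, (e <= B%:E)%E.
  by case: e e_lt => [r|//|] _; [exists r|exists 0; rewrite leNye].
exists B => x0; move/ess_supP: eB => [N [mN N0 hN]].
rewrite leNgt; apply/negP => fx0.
have /nbhs_ballP[d /= d0 hd] : \forall y \near x0, B < `|f y|.
  have cn : {for x0, continuous (fun y => `|f y|)}.
    exact: (continuous_comp (cf x0) (@norm_continuous _ _ (f x0))).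
  by apply: (cvgr_gt _ cn).
have sub : open_box (fun i => x0 0 i) d `<=` N.
  move=> t ht; apply: hN => /=; rewrite lee_fin; apply/negP; rewrite -ltNge.
  apply: hd; split=> // i j; rewrite ord1 mxE -ball_normE /ball_ /=.
  by have := ht j; rewrite in_itv /= ltr_norml => /andP[h1 h2]; apply/andP; split; lra.
have := lebesgue_Rn_open_box_gt0 (fun i => x0 0 i) d0.
rewrite ltNge => /negP; apply.
rewrite -N0; apply: le_measure; rewrite ?inE//; exact: measurable_open_box.
Qed.

(** * Bounds for periodic functions and for gradients *)

Lemma bounded_on_ball {R : realType} {n} (F : 'rV[R]_n -> R) s : continuous F ->
  exists C, forall x, dotv x x <= s -> `|F x| <= C.
Proof.
move=> cF; have [s0|s0] := leP 0 s; last first.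
  by exists 0 => x xs; have := dotv_ge0 x; rewrite leNgt (le_lt_trans xs s0).
have cN : continuous (fun x => `|F x|).
  by apply: continuous_compose cF _; exact: norm_continuous.
have [|||x _ mx] := @EVT_max_rV R n (fun x => `|F x|)
    [set x : 'rV[R]_n | 0 <= dotv (x - 0) (x - 0) <= s].
- by exists 0; rewrite /= subrr dot0v lexx.
- exact: compact_annulus.
- exact: continuous_subspaceT.
exists `|F x| => y ys; apply: mx.
by rewrite inE /= subr0 dotv_ge0.
Qed.

Lemma periodic_bounded {R : realType} {n} (F : 'rV[R]_n -> R) : continuous F ->
  Zn_periodic F -> exists C, forall x, `|F x| <= C.
Proof.
move=> cF pF; have [C hC] := bounded_on_ball n%:R cF; exists C => x.
have [k hk] := near_lattice_point x 0.
by rewrite -(pF k) hC//; move: hk; rewrite subr0.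
Qed.

Lemma Zn_periodic_partial {R : realType} {n} (F : 'rV[R]_n -> R) i :
  Zn_periodic F -> Zn_periodic (partial i F).
Proof.
move=> pF k x; rewrite /partial /derive pF.
by under eq_fun do rewrite /= addrA pF.
Qed.

Section periodic_derivatives.
Context {R : realType} {n : nat} (F : 'rV[R]_n -> R).
Context (sF : smooth F) (pF : Zn_periodic F).

Lemma dotv_gradient_bounded (a : 'rV[R]_n) :
  exists C, forall x, `|dotv a (gradient F x)| <= C.
Proof.
apply: periodic_bounded => [|k x].
  apply: continuous_sum => i; apply: continuous_mul; first exact: continuous_cst.
  rewrite [X in continuous X](_ : _ = partial i F); first exact: (sF [:: i]).1.
  by apply/funext => x; rewrite mxE.
by apply: eq_bigr => i _; rewrite !mxE Zn_periodic_partial.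
Qed.

Lemma sqr_gradient_bounded :
  exists C, forall x, dotv (gradient F x) (gradient F x) <= C.
Proof.
have [||C hC] := @periodic_bounded R n (fun x => dotv (gradient F x) (gradient F x)).
- have cp i : continuous (fun x => gradient F x 0 i).
    rewrite [X in continuous X](_ : _ = partial i F); first exact: (sF [:: i]).1.
    by apply/funext => x; rewrite mxE.
  by apply: continuous_sum => i; exact: continuous_mul.
- by move=> k x; apply: eq_bigr => i _; rewrite !mxE Zn_periodic_partial.
by exists C => x; apply: le_trans (hC x); exact: ler_norm.
Qed.

(** With the lower bound on ln det that the equation provides, this makes A + D^2 psi uniformly
    positive through [sym_posdef_lower_bound]. *)
Lemma mxtrace_hessian_bounded (A : 'M[R]_n) :
  exists C, forall x, \tr (A + hessian F x) <= C.
Proof.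
have [||C hC] := @periodic_bounded R n (fun x => \tr (A + hessian F x)).
- apply: continuous_sum => i.
  rewrite [X in continuous X](_ : _ = (fun x => A i i + partial i (partial i F) x)).
    apply: continuous_add; first exact: continuous_cst.
    exact: (sF [:: i; i]).1.
  by apply/funext => x; rewrite !mxE.
- move=> k x; congr (\tr (_ + _)); apply/matrixP => i j; rewrite !mxE.
  by do 2 apply: Zn_periodic_partial.
by exists C => x; apply: le_trans (hC x); exact: ler_norm.
Qed.

End periodic_derivatives.

(** On the line through x along u, F plus half of A's quadratic form is convex, so its slope at 0 is
    at most its increment over [0, 1]. Both signs follow by taking v and - v. *)
Lemma semiconvex_gradient_bound {R : realType} {n} (A : 'M[R]_n) (F : 'rV[R]_n -> R)
    G H B x v : twice_derivable F G H -> (forall x, sym_posdef (A + H x)) ->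
  (forall x, `|F x| <= B) -> `|dotv (G x) v| <= 2 * B + 2^-1 * quad_form A v.
Proof.
move=> [_ dF ddF] FP FB.
have half u : dotv (G x) u <= 2 * B + 2^-1 * quad_form A u.
  pose f (t : R) := F (x + t *: u) + 2^-1 * quad_form A u * t ^+ 2.
  pose df (t : R) := dotv (G (x + t *: u)) u + quad_form A u * t.
  have f_df (t : R) : is_derive t (1 : R) f (df t).
    have h1 := is_derive_line (dF (x + t *: u) u).
    have h2 : is_derive t (1 : R) ((2^-1 * quad_form A u) \*: (id * id)) (quad_form A u * t).
      by apply: is_derive_eq; rewrite /GRing.scale /=; field.
    exact: (is_deriveD h1 h2).
  have df_ddf (t : R) : is_derive t (1 : R) df (quad_form (A + H (x + t *: u)) u).
    have h1 := is_derive_line (F := fun z => dotv (G z) u) (ddF (x + t *: u) u).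
    have h2 : is_derive t (1 : R) (quad_form A u \*: id) (quad_form A u).
      by apply: is_derive_eq; rewrite /GRing.scale /= mulr1.
    by rewrite quad_formDl addrC; exact: (is_deriveD h1 h2).
  have [c + E1] := MVT (@ltr01 R) (fun t _ => f_df t)
    (derivable_within_continuous (fun t _ => ex_derive (is_derive := f_df t))).
  rewrite in_itv /= => /andP[c0 c1].
  have [c' _ E2] := MVT c0 (fun t _ => df_ddf t)
    (derivable_within_continuous (fun t _ => ex_derive (is_derive := df_ddf t))).
  have : 0 <= df c - df 0.
    by rewrite E2 subr0 mulr_ge0 ?sym_posdef_ge0// ltW.
  have -> : df 0 = dotv (G x) u by rewrite /df scale0r addr0 mulr0 addr0.
  have -> : df c = F (x + u) - F x + 2^-1 * quad_form A u.
    rewrite -[LHS]mulr1 -[X in _ * X](subr0 1) -E1 /f scale1r scale0r addr0.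
    by rewrite expr1n expr0n /=; ring.
  have := FB x; have := FB (x + u); rewrite !ler_norml => /andP[_ h1] /andP[h2 _].
  by lra.
rewrite ler_norml; apply/andP; split; last exact: half.
have := half (- v); rewrite dotvNr -[- v]scaleN1r quad_formZr sqrrN expr1n mul1r; lra.
Qed.

Lemma growth_of_sup {R : realType} {n} (F : 'rV[R]_n -> R) : continuous F ->
  sup [set `|F x| | x in euclidean_ball r] / r ^+ 2 @[r --> +oo] --> 0 ->
  forall e, 0 < e -> exists r0, forall r x, r0 <= r -> dotv x x < r ^+ 2 ->
    `|F x| <= e * r ^+ 2.
Proof.
move=> cF lim e e0.
have := lim; move=> /cvgr0Pnorm_lt /(_ e e0) [M [Mr hM]].
exists (`|M| + 1) => r x Mr' xr.
have Mr2 : M < r by have := ler_norm M; lra.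
have r0 : 0 < r by have := normr_ge0 M; lra.
have r2 : 0 < r ^+ 2 by rewrite exprn_gt0.
have := hM r Mr2; rewrite /= normrM normfV (gtr0_norm r2) ltr_pdivrMr// => h.
apply: ltW; apply: le_lt_trans h; apply: le_trans (ler_norm _).
(* [sup] is an upper bound only for a set that is bounded above; continuity on compact balls
   provides this. *)
apply: sup_upper_bound; last first.
  by exists x => //; rewrite /euclidean_ball /= -ltr_sqr ?nnegrE ?sqrtr_ge0 ?ltW// sqr_sqrtr ?dotv_ge0.
split; first by exists `|F x|, x => //; rewrite /euclidean_ball /= -ltr_sqr ?nnegrE ?sqrtr_ge0 ?ltW// sqr_sqrtr ?dotv_ge0.
have [C hC] := bounded_on_ball (r ^+ 2) cF.
exists C => _ [y yr <-]; apply: hC.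
move: yr; rewrite /euclidean_ball /= -ltr_sqr ?nnegrE ?sqrtr_ge0 ?(ltW r0)// sqr_sqrtr ?dotv_ge0//.
exact: ltW.
Qed.

Lemma dotv_delta {R : realType} {n} (x : 'rV[R]_n) i : dotv x (delta_mx 0 i) = x 0 i.
Proof. by rewrite dotv_mul trmx_delta -colE mxE. Qed.

Theorem theorem1p3 (R : realType) (n : nat) (a b : 'rV[R]_n) (c0 : R)
    (V u : 'rV[R]_n -> R) (A : 'M[R]_n) (l : 'rV[R]_n)
    (V_smooth : smooth V) (V_periodic : Zn_periodic V)
    (u_smooth : smooth u) (u_convex : strictly_convex u)
    (u_eq : forall x, \det (hessian u x)
                      = expR (- dotv a (gradient u x) + dotv b x + V x - c0))
    (A_posdef : sym_posdef A) :
  let f := fun x : 'rV[R]_n => u x - 2^-1 * quad_form A x - dotv l x in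
  sup [set `|f x| | x in euclidean_ball r] / r ^+ 2 @[r --> +oo] --> 0 ->
  b^T = A *m a^T /\
  (Linfty f ->
   forall (psi_A : 'rV[R]_n -> R) (c_A : R), cell_pair A a V psi_A c_A ->
   c0 + dotv a l = c_A /\
   exists C : R, forall x,
     u x = 2^-1 * quad_form A x + dotv l x + psi_A x + C).
Proof.
move=> f f_sup; have [sA _] := A_posdef.
have f2 := twice_derivableB (twice_derivableB (smooth_twice_derivable u_smooth)
  (twice_derivable_quad_form sA)) (twice_derivable_dotv l).
rewrite -/f in f2.
set Gf := fun x => gradient u x - _ - _ in f2; set Hf := fun x => _ - _ - _ in f2.
have [cf _ _] := f2.
have AH x : A + Hf x = hessian u x by rewrite /Hf subr0 subrKC.
have fP x : sym_posdef (A + Hf x) by rewrite AH; exact: u_convex.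
(* Passing from u to f moves the quadratic and linear parts into the data: b becomes b - a A and c0
   becomes c0 + a.l. *)
have fE x : ln (\det (A + Hf x)) =
    - dotv a (Gf x) + dotv (b - a *m A) x + V x - (c0 + dotv a l).
  rewrite AH u_eq expRK /Gf !dotvDr !dotvDl !dotvNr !dotvNl.
  have -> : dotv a (x *m A) = dotv (a *m A) x.
    by rewrite !dotv_mul trmx_mul sA mulmxA.
  by ring.
have [CV hCV] : exists C, forall x, `|V x| <= C.
  exact: periodic_bounded (V_smooth [::]).1 V_periodic.
have bE : b = a *m A.
  apply/eqP; rewrite -subr_eq0; apply/eqP.
  exact: (drift_vanishes A_posdef f2 fP fE hCV (growth_of_sup cf f_sup)).
split; first by rewrite bE trmx_mul sA.
move=> fL psi c [psi_smooth psi_per _ psi_eq psiP].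
have f_sol : ma_solution A a V (c0 + dotv a l) f Gf Hf.
  by split=> // x; rewrite fE bE subrr dot0v addr0.
have psi_sol : ma_solution A a V c psi (gradient psi) (hessian psi).
  by split=> // [|x]; [exact: smooth_twice_derivable|rewrite psi_eq expRK].
have [Bf hBf] := Linfty_bounded cf fL.
have [Bp hBp] : exists C, forall x, `|psi x| <= C.
  exact: periodic_bounded (psi_smooth [::]).1 psi_per.
have fB x : `|f x - psi x| <= Bf + Bp.
  by apply: le_trans (ler_normB _ _) _; exact: lerD.
have [t ht] := mxtrace_hessian_bounded psi_smooth psi_per A.
have [da hda] := dotv_gradient_bounded psi_smooth psi_per a.
have [K1 hK1] := sqr_gradient_bounded psi_smooth psi_per.
have psi_ln x : `|ln (\det (A + hessian psi x))| <= da + CV + `|c|.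
  rewrite psi_eq expRK; apply: le_trans (ler_normB _ _) _; rewrite lerD2r.
  by apply: le_trans (ler_normD _ _) _; rewrite normrN lerD.
have [mu mu0 hmu] := sym_posdef_lower_bound n t (da + CV + `|c|).
have {}hmu x z : mu * dotv z z <= quad_form (A + hessian psi x) z.
  by apply: hmu => //; have := psi_ln x; rewrite ler_norml => /andP[].
have cE := ma_constant_unique f_sol psi_sol mu0 hmu fB.
split=> //; rewrite cE in f_sol.
(* The gradient of f is bounded one coordinate at a time, with v a basis vector in
   [semiconvex_gradient_bound]. *)
pose K2 := \sum_(i < n) (2 * Bf + 2^-1 * A i i) ^+ 2.
have hK2 x : dotv (Gf x) (Gf x) <= K2.
  apply: ler_sum => i _; rewrite -expr2.
  have := semiconvex_gradient_bound x (delta_mx 0 i) f2 fP hBf.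
  rewrite dotv_delta quad_form_delta => h.
  by rewrite -real_normK ?num_real// ler_pXn2r ?nnegrE// (le_trans _ h).
have fK x : dotv (Gf x - gradient psi x) (Gf x - gradient psi x) <= 2 * K2 + 2 * K1.
  apply: le_trans (dotv_parallelogram _ _) _; rewrite dotvNl dotvNr opprK.
  by have := hK2 x; have := hK1 x; lra.
(* The sum of separate upper bounds for ln det at f and at psi, so that one D serves both. *)
pose D := (dotv a a + K2) / 2 + CV + `|c| + (da + CV + `|c|).
have CV0 : 0 <= CV by apply: le_trans (hCV 0).
have da0 : 0 <= da by apply: le_trans (hda 0).
have K20 : 0 <= K2 by apply: le_trans (hK2 0); exact: dotv_ge0.
have fD x : ln (\det (A + Hf x)) <= D.
  have [_ _ ->] := f_sol.
  have := @dotv_young _ _ 1 a (Gf x) ltr01; rewrite invr1 !mul1r ler_norml => /andP[h1 _].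
  have := hCV x; rewrite ler_norml => /andP[_ h2].
  have h3 := hK2 x; have h4 := normr_ge0 c.
  have h5 : - c <= `|c| by rewrite -normrN ler_norm.
  by rewrite /D; lra.
have psiD x : ln (\det (A + hessian psi x)) <= D.
  have := psi_ln x; rewrite ler_norml => /andP[_].
  by have := normr_ge0 c; have := dotv_ge0 a; rewrite /D; lra.
have [C hC] := liouville psi_sol f_sol mu0 hmu fK fB fD psiD V_periodic psi_per.
by exists C => x; have := hC x; rewrite /f; lra.
Qed.
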